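(* Every free group is uniformly exact.
   Context: All groups are discrete. Fix a free ultrafilter $\mathcal{U}$ on $\mathbb{N}$. The ultrapower of a group $\Gamma$ is $\Gamma^{\mathcal U}=\prod_{\mathbb N}\Gamma/{\sim}$, where $(s_n)_n\sim(t_n)_n$ iff $\{n:s_n=t_n\}\in\mathcal U$; the class of $(s_n)_n$ is written $[s_n]_n$. The ultrapower of a C*-algebra $A$ is $A^{\mathcal U}=\ell_\infty(\mathbb N,A)/\{(a_n)_n:\lim_{\mathcal U}\|a_n\|=0\}$. A group $\Gamma$ acts on the C*-algebra $\ell_\infty\Gamma$ of bounded functions by $(sf)(x)=f(s^{-1}x)$, and $\Gamma^{\mathcal U}$ acts on $(\ell_\infty\Gamma)^{\mathcal U}$ by $[s_n]_n[f_n]_n=[s_nf_n]_n$. For a group $G$, $\mathrm{Prob}\,G\subset\ell_1G$ is the set of probability measures on $G$ with the $\ell_1$-norm topology and the left translation action $(s\xi)(t)=\xi(s^{-1}t)$. An action of $G$ on a unital commutative C*-algebra $C(K)$ ($K$ compact Hausdorff) is amenable if, for the corresponding action of $G$ on $K$ by homeomorphisms, there is a net of continuous maps $\eta_i\colon K\to\mathrm{Prob}\,G$, $x\mapsto \eta_i^x$, such that $\lim_i\sup_{x\in K}\|\eta_i^{sx}-s\eta_i^x\|_1=0$ for every $s\in G$. A group $\Gamma$ is uniformly exact (or uniformly amenable at infinity) if the action of $\Gamma^{\mathcal U}$ on $(\ell_\infty\Gamma)^{\mathcal U}$ is amenable. *)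

(* Defs.v *)
(* MathComp / MathComp-Analysis.  The scalars are R[i] for R : realType. *)
From HB Require Import structures.
From mathcomp Require Import all_boot all_order all_algebra complex.
From mathcomp Require Import all_classical all_reals.
From mathcomp Require Import topology normedtype esum.

Set Implicit Arguments.
Unset Strict Implicit.
Unset Printing Implicit Defensive.

Import Order.TTheory GRing.Theory Num.Theory.
Import numFieldNormedType.Exports.
Import ComplexField.Normc.

Local Open Scope classical_set_scope.
Local Open Scope ring_scope.
Local Open Scope quotient_scope.

Record free_ultrafilter := FreeUltrafilter {
  fu_sets : set_system nat;
  fu_ultra : UltraFilter fu_sets;
  fu_free : \bigcap_(A in fu_sets) A = set0 }.

#[global] Existing Instance fu_ultra.

(* Universal property: G is free on the family i : X -> G. *)
Definition free_on (G : groupType) (X : Type) (i : X -> G) : Prop :=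
  forall (H : groupType) (f : X -> H),
    exists! phi : G -> H,
      {morph phi : x y / (x * y)%g >-> (x * y)%g} /\ phi \o i = f.

Definition free_group (G : groupType) : Prop :=
  exists (X : Type) (i : X -> G), free_on i.

Section GroupUltrapower.
Variables (U : free_ultrafilter) (G : groupType).
Implicit Types s t : nat -> G.

Definition gueq s t : bool := `[< fu_sets U [set n | s n = t n] >].

Lemma gueq_equiv : equiv_class_of gueq.
Proof.
split.
- by move=> s; apply/asboolP; apply: filterE.
- by move=> s t; apply/asboolP/asboolP; apply: filterS => n /= ->.
- move=> t s r /asboolP st /asboolP tr; apply/asboolP.
  by apply: filterS2 st tr => n /= -> ->.
Qed.

Canonical gueq_equivRel := EquivRelPack gueq_equiv.

Definition gultrapower : Type := {eq_quot gueq_equivRel}.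

HB.instance Definition _ : EqQuotient _ gueq gultrapower :=
  EqQuotient.on gultrapower.
HB.instance Definition _ := Choice.on gultrapower.

(* The class [s_n]_n. *)
Definition gclass s : gultrapower := \pi s.

Lemma gclassP s t : gclass s = gclass t <-> fu_sets U [set n | s n = t n].
Proof.
rewrite /gclass; split; first by move/eqmodP/asboolP.
by move=> st; apply/eqmodP/asboolP.
Qed.

Lemma gclass_repr (a : gultrapower) : gclass (repr a) = a.
Proof. exact: reprK. Qed.

Definition gu1 : gultrapower := gclass (fun=> 1%g).
Definition guV (a : gultrapower) : gultrapower :=
  gclass (fun n => ((repr a n)^-1)%g).
Definition guM (a b : gultrapower) : gultrapower :=
  gclass (fun n => (repr a n * repr b n)%g).

Lemma repr_gclass s : fu_sets U [set n | repr (gclass s) n = s n].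
Proof. by apply/gclassP; rewrite gclass_repr. Qed.

Lemma guM_class s t : guM (gclass s) (gclass t) = gclass (fun n => (s n * t n)%g).
Proof.
apply/gclassP; apply: filterS2 (repr_gclass s) (repr_gclass t).
by move=> n /= -> ->.
Qed.

Lemma guV_class s : guV (gclass s) = gclass (fun n => ((s n)^-1)%g).
Proof. by apply/gclassP; apply: filterS (repr_gclass s) => n /= ->. Qed.

Lemma guA : associative guM.
Proof.
move=> a b c; rewrite -(gclass_repr a) -(gclass_repr b) -(gclass_repr c).
by rewrite !guM_class; congr gclass; apply/funext => n; rewrite mulgA.
Qed.

Lemma gu1M : left_id gu1 guM.
Proof.
move=> a; rewrite -(gclass_repr a) guM_class; congr gclass.
by apply/funext => n; rewrite mul1g.
Qed.

Lemma guM1 : right_id gu1 guM.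
Proof.
move=> a; rewrite -(gclass_repr a) guM_class; congr gclass.
by apply/funext => n; rewrite mulg1.
Qed.

Lemma guVM : left_inverse gu1 guV guM.
Proof.
move=> a; rewrite -(gclass_repr a) guV_class guM_class; congr gclass.
by apply/funext => n; rewrite mulVg.
Qed.

Lemma guMV : right_inverse gu1 guV guM.
Proof.
move=> a; rewrite -(gclass_repr a) guV_class guM_class; congr gclass.
by apply/funext => n; rewrite mulgV.
Qed.

HB.instance Definition _ := isGroup.Build gultrapower guA gu1M guM1 guVM guMV.

End GroupUltrapower.

(* A unital commutative complex algebra with a submultiplicative norm: the part
   of the structure of a C*-algebra on which its ultrapower depends. *)
HB.mixin Record ComAlgebra_isNormed (R : realType) A
    of GRing.ComAlgebra R[i] A := {
  anorm : A -> R;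
  anorm0_eq0 : forall a, anorm a = 0 -> a = 0;
  anormD : forall a b, anorm (a + b) <= anorm a + anorm b;
  anormZ : forall (c : R[i]) a, anorm (c *: a) = normc c * anorm a;
  anormM : forall a b, anorm (a * b) <= anorm a * anorm b;
  anorm1 : anorm 1 = 1 }.

#[short(type="normedComAlgType")]
HB.structure Definition NormedComAlg (R : realType) :=
  {A of ComAlgebra_isNormed R A & GRing.ComAlgebra R[i] A}.

Lemma normc_ge0 (R : rcfType) (c : R[i]) : 0 <= normc c.
Proof. by case: c => a b; exact: sqrtr_ge0. Qed.

Section NormedComAlgTheory.
Variables (R : realType) (A : normedComAlgType R).

Lemma normcN1 : normc (-1 : R[i]) = 1.
Proof. by rewrite /= oppr0 expr0n/= addr0 sqrrN expr1n sqrtr1. Qed.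

Lemma anorm0 : anorm (0 : A) = 0.
Proof.
by rewrite -[0 in LHS](scale0r (1 : A)) anormZ /= expr0n/= addr0 sqrtr0 mul0r.
Qed.

Lemma anormN (a : A) : anorm (- a) = anorm a.
Proof. by rewrite -scaleN1r anormZ normcN1 mul1r. Qed.

Lemma anorm_ge0 (a : A) : 0 <= anorm a.
Proof.
have := anormD a (- a); rewrite subrr anorm0 anormN -mulr2n.
by rewrite pmulrn_lge0.
Qed.

End NormedComAlgTheory.

Section Scalars.
Variable R : realType.

HB.instance Definition _ := GRing.ComAlgebra.on R[i]^o.

Lemma cnorm0_eq0 (a : R[i]^o) : normc a = 0 -> a = 0.
Proof. exact: eq0_normc. Qed.

Lemma cnormD (a b : R[i]^o) :
  normc (a + b) <= normc a + normc b.
Proof. exact: le_normcD. Qed.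

Lemma cnormM (a b : R[i]^o) :
  normc (a * b) <= normc a * normc b.
Proof. by rewrite normcM. Qed.

Lemma cnormZ (c : R[i]) (a : R[i]^o) :
  normc (c *: a) = normc c * normc a.
Proof. exact: normcM. Qed.

Lemma cnorm1 : normc (1 : R[i]^o) = 1.
Proof. by rewrite /= expr0n/= addr0 expr1n sqrtr1. Qed.

HB.instance Definition _ := @ComAlgebra_isNormed.Build R R[i]^o
  (@normc R) cnorm0_eq0 cnormD cnormZ cnormM cnorm1.

End Scalars.

Section BoundedFunctions.
Variables (R : realType) (T : pointedType) (A : normedComAlgType R).

Definition is_bounded (f : T -> A) : Prop :=
  exists M : R, forall x, anorm (f x) <= M.

Definition bounded_pred : {pred T -> A} := fun f => `[< is_bounded f >].

(* The bounded functions T -> A, with pointwise operations. *)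
Record linf := Linf { linf_fun :> T -> A; _ : linf_fun \in bounded_pred }.

HB.instance Definition _ := [isSub for linf_fun].
HB.instance Definition _ := [Choice of linf by <:].

Lemma linfP (f : linf) : is_bounded f.
Proof. by case: f => f /= /asboolP. Qed.

Lemma mklinf_subproof (f : T -> A) : is_bounded f -> f \in bounded_pred.
Proof. by move=> ?; apply/asboolP. Qed.

Definition mklinf (f : T -> A) (fb : is_bounded f) : linf :=
  Linf (mklinf_subproof fb).

Lemma linf_eqP (f g : linf) : (forall x, f x = g x) -> f = g.
Proof. by move=> fg; apply/val_inj/funext. Qed.

Lemma bounded_subring : subring_closed bounded_pred.
Proof.
split=> [|f g /asboolP[M fM] /asboolP[N gN]|f g /asboolP[M fM] /asboolP[N gN]];
  apply/asboolP.
- by exists 1 => x; rewrite [X in anorm X]/(1 : A) anorm1.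
- exists (M + N) => x; rewrite (le_trans (anormD _ _))// anormN.
  exact: lerD.
- exists (M * N) => x; rewrite (le_trans (anormM _ _))//.
  by apply: ler_pM => //; exact: anorm_ge0.
Qed.

HB.instance Definition _ :=
  GRing.SubChoice_isSubComPzRing.Build (T -> A) bounded_pred linf
    bounded_subring.

Lemma bounded_scale (c : R[i]) (f : linf) : is_bounded (fun x => c *: f x).
Proof.
have [M fM] := linfP f; exists (normc c * M) => x.
by rewrite anormZ ler_wpM2l// normc_ge0.
Qed.

Definition linf_scale (c : R[i]) (f : linf) : linf := mklinf (bounded_scale c f).

Lemma linf_scaleA c d f : linf_scale c (linf_scale d f) = linf_scale (c * d) f.
Proof. by apply: linf_eqP => x /=; rewrite scalerA. Qed.

Lemma linf_scale1 : left_id 1 linf_scale.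
Proof. by move=> f; apply: linf_eqP => x /=; rewrite scale1r. Qed.

Lemma linf_scaleDr : right_distributive linf_scale +%R.
Proof. by move=> c f g; apply: linf_eqP => x /=; rewrite scalerDr. Qed.

Lemma linf_scaleDl f : {morph linf_scale^~ f : c d / c + d}.
Proof. by move=> c d; apply: linf_eqP => x /=; rewrite scalerDl. Qed.

HB.instance Definition _ := GRing.Zmodule_isLmodule.Build R[i] linf
  linf_scaleA linf_scale1 linf_scaleDr linf_scaleDl.

Lemma linf_oner_neq0 : (1 : linf) != 0.
Proof.
apply/eqP => /(congr1 (fun f : linf => f point)) /eqP.
by rewrite [_ == _](oner_eq0 A).
Qed.

HB.instance Definition _ := GRing.PzSemiRing_isNonZero.Build linf linf_oner_neq0.

Lemma linf_scaleAl (c : R[i]) (f g : linf) : c *: (f * g) = (c *: f) * g.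
Proof. by apply: linf_eqP => x /=; rewrite scalerAl. Qed.

HB.instance Definition _ :=
  GRing.Lmodule_isLalgebra.Build R[i] linf linf_scaleAl.
HB.instance Definition _ := GRing.Lalgebra_isComAlgebra.Build R[i] linf.

Definition linf_norm (f : linf) : R := sup (range (fun x => anorm (f x))).

Lemma linf_norm_has_sup (f : linf) : has_sup (range (fun x => anorm (f x))).
Proof.
split; first by exists (anorm (f point)), point.
by have [M fM] := linfP f; exists M => _ [x _ <-].
Qed.

Lemma linf_norm_ub (f : linf) x : anorm (f x) <= linf_norm f.
Proof. by apply: ub_le_sup; [exact: (linf_norm_has_sup f).2|exists x]. Qed.

Lemma linf_norm_le (f : linf) (M : R) :
  (forall x, anorm (f x) <= M) -> linf_norm f <= M.
Proof.
move=> fM; apply: ge_sup; first exact: (linf_norm_has_sup f).1.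
by move=> _ [x _ <-].
Qed.

Lemma linf_norm0_eq0 f : linf_norm f = 0 -> f = 0.
Proof.
move=> f0; apply: linf_eqP => x; apply: anorm0_eq0.
by apply/eqP; rewrite eq_le anorm_ge0 -[X in _ <= X]f0 linf_norm_ub.
Qed.

Lemma linf_normD f g : linf_norm (f + g) <= linf_norm f + linf_norm g.
Proof.
apply: linf_norm_le => x; rewrite (le_trans (anormD _ _))//.
by apply: lerD; exact: linf_norm_ub.
Qed.

Lemma linf_normM f g : linf_norm (f * g) <= linf_norm f * linf_norm g.
Proof.
apply: linf_norm_le => x; rewrite (le_trans (anormM _ _))//.
by apply: ler_pM; rewrite ?anorm_ge0 ?linf_norm_ub.
Qed.

Lemma linf_normZ_le (c : R[i]) (f : linf) :
  linf_norm (c *: f) <= normc c * linf_norm f.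
Proof.
apply: linf_norm_le => x /=; rewrite anormZ ler_wpM2l ?linf_norm_ub//.
exact: normc_ge0.
Qed.

Lemma linf_norm1 : linf_norm 1 = 1.
Proof.
apply/eqP; rewrite eq_le; apply/andP; split.
  by apply: linf_norm_le => x; rewrite [X in anorm X]/(1 : A) anorm1.
by have := linf_norm_ub 1 point; rewrite [X in anorm X]/(1 : A) anorm1.
Qed.

Lemma linf_normZ (c : R[i]) (f : linf) :
  linf_norm (c *: f) = normc c * linf_norm f.
Proof.
have [->|c0] := eqVneq c 0.
  rewrite scale0r normc0 mul0r; apply/eqP; rewrite eq_le; apply/andP; split.
    by apply: linf_norm_le => x; rewrite [X in anorm X]/(0 : A) anorm0.
  by have := linf_norm_ub 0 point; rewrite [X in anorm X]/(0 : A) anorm0.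
apply/eqP; rewrite eq_le linf_normZ_le/=.
have nc0 : 0 < normc c.
  rewrite lt_neqAle normc_ge0 andbT eq_sym.
  by apply: contra_neq c0 => /eq0_normc.
rewrite -ler_pdivlMl// -normcV (le_trans _ (linf_normZ_le _ _))//.
by rewrite scalerA mulVf// scale1r.
Qed.

HB.instance Definition _ := @ComAlgebra_isNormed.Build R linf
  linf_norm linf_norm0_eq0 linf_normD linf_normZ linf_normM linf_norm1.

End BoundedFunctions.

Arguments linf {R} T A.

Section AlgebraUltrapower.
Variables (R : realType) (U : free_ultrafilter) (A : normedComAlgType R).

(* The ideal of those (a_n)_n in l_oo(N, A) with lim_U ||a_n|| = 0. *)
Definition null_ideal : {pred linf nat A} :=
  fun a => `[< anorm (a n) @[n --> fu_sets U] --> (0 : R) >].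

Lemma null_idealP (a : linf nat A) : reflect
  (forall e : R, 0 < e -> fu_sets U [set n | anorm (a n) < e]) (a \in null_ideal).
Proof.
apply: (iffP (asboolP (anorm (a n) @[n --> fu_sets U] --> (0 : R)))) => [/cvgrPdist_lt a0 e e0|a0].
  apply: filterS (a0 _ e0) => n /=.
  by rewrite sub0r normrN ger0_norm ?anorm_ge0.
apply/cvgrPdist_lt => e e0; apply: filterS (a0 _ e0) => n /=.
by rewrite sub0r normrN ger0_norm ?anorm_ge0.
Qed.

Lemma null_ideal_closed : idealr_closed null_ideal.
Proof.
split.
- apply/null_idealP => e e0; apply: filterE => n /=.
  by rewrite [X in anorm X](_ : _ = 0)// anorm0.
- apply/negP => /null_idealP/(_ 1 ltr01); rewrite [X in fu_sets U X](_ : _ = set0).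
    exact: filter_not_empty.
  by rewrite predeqE => n; split => //=; rewrite [X in anorm X](_ : _ = 1)// anorm1 ltxx.
- move=> a u v /null_idealP u0 /null_idealP v0; apply/null_idealP => e e0.
  have [M aM] := linfP a.
  have M1 : 0 < `|M| + 1 by rewrite ltr_wpDl.
  have := u0 (e / 2 / (`|M| + 1)); rewrite !divr_gt0// => /(_ isT) u1.
  have := v0 (e / 2); rewrite divr_gt0// => /(_ isT) v1.
  apply: filterS2 u1 v1 => n /= un vn.
  rewrite (le_lt_trans (anormD _ _))// (splitr e) ltrD//.
  rewrite (le_lt_trans (anormM _ _))//.
  rewrite (@le_lt_trans _ _ ((`|M| + 1) * anorm (u n)))//.
    rewrite ler_wpM2r ?anorm_ge0// (le_trans (aM n))// (le_trans (ler_norm _))//.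
    by rewrite lerDl.
  by rewrite mulrC -ltr_pdivlMr.
Qed.

HB.instance Definition _ :=
  isIdealr.Build (linf nat A) null_ideal null_ideal_closed.

Definition ultrapower : Type := {ideal_quot null_ideal}.

HB.instance Definition _ := GRing.ComNzRing.on ultrapower.

(* The class [a_n]_n of a bounded sequence. *)
Definition aclass (a : linf nat A) : ultrapower := \pi_{ideal_quot null_ideal} a.

Lemma aclassP a b : aclass a = aclass b <-> a - b \in null_ideal.
Proof.
rewrite /aclass; split=> [/eqP|ab]; first by rewrite -Quotient.idealrBE.
by apply/eqP; rewrite -Quotient.idealrBE.
Qed.

Definition arepr (a : ultrapower) : linf nat A :=
  repr (a : {ideal_quot null_ideal}).

Lemma arepr_class a : aclass (arepr a) = a.
Proof. exact: reprK. Qed.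

Lemma aclassD a b : aclass (a + b) = aclass a + aclass b.
Proof. exact: (rmorphD \pi_{ideal_quot null_ideal}). Qed.

Lemma aclassM a b : aclass (a * b) = aclass a * aclass b.
Proof. exact: (rmorphM \pi_{ideal_quot null_ideal}). Qed.

Lemma aclass1 : aclass 1 = 1.
Proof. exact: (rmorph1 \pi_{ideal_quot null_ideal}). Qed.

Definition uscale (c : R[i]) (a : ultrapower) : ultrapower :=
  aclass (c *: arepr a).

Lemma uscale_class c a : uscale c (aclass a) = aclass (c *: a).
Proof.
apply/aclassP; rewrite -scalerBr -[_ - _]mul1r scalerAl.
by rewrite idealMr//; apply/aclassP; rewrite arepr_class.
Qed.

Lemma uscaleA c d a : uscale c (uscale d a) = uscale (c * d) a.
Proof. by rewrite -(arepr_class a) !uscale_class scalerA. Qed.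

Lemma uscale1 : left_id 1 uscale.
Proof. by move=> a; rewrite -(arepr_class a) uscale_class scale1r. Qed.

Lemma uscaleDr : right_distributive uscale +%R.
Proof.
move=> c a b; rewrite -(arepr_class a) -(arepr_class b) -aclassD.
by rewrite !uscale_class scalerDr aclassD.
Qed.

Lemma uscaleDl a : {morph uscale^~ a : c d / c + d}.
Proof.
by move=> c d; rewrite -(arepr_class a) !uscale_class scalerDl aclassD.
Qed.

HB.instance Definition _ := GRing.Zmodule_isLmodule.Build R[i] ultrapower
  uscaleA uscale1 uscaleDr uscaleDl.

Lemma uscaleAl (c : R[i]) (a b : ultrapower) : c *: (a * b) = (c *: a) * b.
Proof.
have scE (d : R[i]) (u : ultrapower) : d *: u = uscale d u by [].
rewrite -(arepr_class a) -(arepr_class b) !scE -aclassM.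
by rewrite !uscale_class -aclassM scalerAl.
Qed.

HB.instance Definition _ :=
  GRing.Lmodule_isLalgebra.Build R[i] ultrapower uscaleAl.
HB.instance Definition _ := GRing.Lalgebra_isComAlgebra.Build R[i] ultrapower.

Lemma aclassZ (c : R[i]) a : aclass (c *: a) = c *: aclass a.
Proof. by rewrite -uscale_class. Qed.

End AlgebraUltrapower.

Arguments null_ideal {R} U {A}.
Arguments ultrapower {R} U A.

Record alg_action (R : realType) (G : groupType) (A : comAlgType R[i]) :=
  AlgAction {
    aact :> G -> {lrmorphism A -> A};
    aact1 : forall a, aact 1%g a = a;
    aactM : forall s t a, aact (s * t)%g a = aact s (aact t a) }.

(* groupType has no pointedType instance; the base point only serves to make
   linf a nontrivial ring. *)
Definition carrier (G : groupType) : Type := G.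
HB.instance Definition _ (G : groupType) := Choice.on (carrier G).
HB.instance Definition _ (G : groupType) := isPointed.Build (carrier G) (1%g : G).

Section Translation.
Variables (R : realType) (G : groupType).

Definition linf_group : Type := linf (carrier G) R[i]^o.

HB.instance Definition _ := NormedComAlg.on linf_group.

Implicit Types (s t : G) (f g : linf_group).

Lemma ltrans_subproof s f :
  is_bounded (fun x : carrier G => f (s^-1 * x)%g : R[i]^o).
Proof. by have [M fM] := linfP f; exists M => x; exact: fM. Qed.

Definition ltrans s f : linf_group := mklinf (ltrans_subproof s f).

Lemma ltransE s f (x : G) : ltrans s f x = f (s^-1 * x)%g.
Proof. by []. Qed.

Lemma ltrans_zmod s : zmod_morphism (ltrans s).
Proof. by move=> f g; apply: linf_eqP. Qed.

Lemma ltrans_monoid s : monoid_morphism (ltrans s).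
Proof. by split=> [|f g]; apply: linf_eqP. Qed.

Lemma ltrans_scalable s : scalable (ltrans s).
Proof. by move=> c f; apply: linf_eqP. Qed.

HB.instance Definition _ s :=
  GRing.isZmodMorphism.Build linf_group linf_group (ltrans s) (ltrans_zmod s).
HB.instance Definition _ s :=
  GRing.isMonoidMorphism.Build linf_group linf_group (ltrans s) (ltrans_monoid s).
HB.instance Definition _ s :=
  GRing.isScalable.Build R[i] linf_group linf_group *:%R (ltrans s)
    (ltrans_scalable s).

Lemma ltrans1 f : ltrans 1%g f = f.
Proof. by apply: linf_eqP => x; rewrite ltransE invg1 mul1g. Qed.

Lemma ltransM s t f : ltrans (s * t)%g f = ltrans s (ltrans t f).
Proof. by apply: linf_eqP => x; rewrite !ltransE invgM mulgA. Qed.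

Definition translation : alg_action G linf_group := AlgAction ltrans1 ltransM.

Lemma anorm_ltrans s f : anorm (ltrans s f) = anorm f.
Proof.
have le t (g : linf_group) : anorm (ltrans t g) <= anorm g.
  by apply: linf_norm_le => x; exact: (linf_norm_ub g).
apply/eqP; rewrite eq_le le/= -[X in anorm X <= _]ltrans1 -(mulVg s) ltransM.
exact: le.
Qed.

Variable U : free_ultrafilter.

Lemma seq_trans_subproof (s : nat -> G) (f : linf nat linf_group) :
  is_bounded (fun n => ltrans (s n) (f n) : linf_group).
Proof.
by have [M fM] := linfP f; exists M => n; rewrite anorm_ltrans; exact: fM.
Qed.

Definition seq_trans (s : nat -> G) (f : linf nat linf_group) :
  linf nat linf_group := mklinf (seq_trans_subproof s f).

Definition utrans (s : gultrapower U G) (f : ultrapower U linf_group) :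
  ultrapower U linf_group := aclass U (seq_trans (repr s) (arepr f)).

(* [s_n]_n [f_n]_n = [s_n f_n]_n *)
Lemma utrans_class (s : nat -> G) (f : linf nat linf_group) :
  utrans (gclass U s) (aclass U f) = aclass U (seq_trans s f).
Proof.
apply/aclassP/null_idealP => e e0.
have /null_idealP/(_ e e0) : arepr (aclass U f) - f \in null_ideal U.
  by apply/aclassP; rewrite arepr_class.
apply: filterS2 (repr_gclass U s) => n /= sn.
set d : linf_group := arepr (aclass U f) n - f n.
rewrite [X in anorm X < _ -> _](_ : _ = d)//.
rewrite [X in _ -> anorm X < _](_ : _ = ltrans (s n) d) ?anorm_ltrans//.
transitivity (ltrans (repr (gclass U s) n) (arepr (aclass U f) n)
              - ltrans (s n) (f n)); first by [].
by rewrite sn raddfB.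
Qed.

Implicit Types (a b : gultrapower U G) (h k : ultrapower U linf_group).

Lemma utrans_zmod a : zmod_morphism (utrans a).
Proof.
move=> h k; rewrite -(gclass_repr a) -(arepr_class h) -(arepr_class k).
have H (f g : linf nat linf_group) : aclass U f - aclass U g = aclass U (f - g).
  by rewrite aclassD -scaleN1r -aclassZ scaleN1r.
rewrite H !utrans_class H; congr aclass.
by apply: linf_eqP => n /=; exact: (ltrans_zmod (repr a n)).
Qed.

Lemma utrans_monoid a : monoid_morphism (utrans a).
Proof.
rewrite -(gclass_repr a); split=> [|h k].
  rewrite -aclass1 utrans_class; congr aclass; apply: linf_eqP => n.
  exact: (ltrans_monoid (repr a n)).1.
rewrite -(arepr_class h) -(arepr_class k) -aclassM !utrans_class -aclassM.
by congr aclass; apply: linf_eqP => n; exact: (ltrans_monoid (repr a n)).2.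
Qed.

Lemma utrans_scalable a : scalable (utrans a).
Proof.
move=> c h; rewrite -(gclass_repr a) -(arepr_class h) -aclassZ !utrans_class.
rewrite -aclassZ; congr aclass; apply: linf_eqP => n.
exact: (ltrans_scalable (repr a n)).
Qed.

HB.instance Definition _ a := GRing.isZmodMorphism.Build
  (ultrapower U linf_group) (ultrapower U linf_group) (utrans a) (utrans_zmod a).
HB.instance Definition _ a := GRing.isMonoidMorphism.Build
  (ultrapower U linf_group) (ultrapower U linf_group) (utrans a)
  (utrans_monoid a).
HB.instance Definition _ a := GRing.isScalable.Build R[i]
  (ultrapower U linf_group) (ultrapower U linf_group) *:%R (utrans a)
  (utrans_scalable a).

Lemma utrans1 h : utrans 1%g h = h.
Proof.
rewrite -(arepr_class h) [1%g]/(gclass U (fun=> 1%g)) utrans_class.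
by congr aclass; apply: linf_eqP => n; exact: ltrans1.
Qed.

Lemma utransM a b h : utrans (a * b)%g h = utrans a (utrans b h).
Proof.
rewrite -(gclass_repr a) -(gclass_repr b) -(arepr_class h).
rewrite [(_ * _)%g]guM_class !utrans_class; congr aclass.
by apply: linf_eqP => n; exact: ltransM.
Qed.

Definition utranslation :
    alg_action (gultrapower U G) (ultrapower U linf_group) :=
  AlgAction utrans1 utransM.

End Translation.

Section Spectrum.
Variables (R : realType) (A : comAlgType R[i]).

(* The Gelfand spectrum of A, with the topology of pointwise convergence on A;
   if A is a commutative unital C*-algebra then A = C(spectrum). *)
Definition character : Type := {lrmorphism A -> R[i]^o}.
HB.instance Definition _ := gen_eqMixin character.
HB.instance Definition _ := gen_choiceMixin character.

Definition spectrum : Type :=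
  initial_topology (fun chi : character => (chi : A -> R[i]^o) : {ptws A -> R[i]^o}).
HB.instance Definition _ := Topological.on spectrum.

(* The dual action (s . chi)(a) = chi (s^-1 . a), so that under A = C(spectrum)
   one has (s . a)(chi) = a (s^-1 . chi). *)
Definition spectrum_act (G : groupType) (act : alg_action G A)
    (s : G) (chi : spectrum) : spectrum :=
  ((chi : character) \o act (s^-1)%g : character).

Lemma spectrum_eqP (chi psi : spectrum) :
  (forall a : A, (chi : character) a = (psi : character) a) -> chi = psi.
Proof.
destruct chi as [f [[p1] [p2] [p3]]], psi as [g [[q1] [q2] [q3]]].
move=> /funext /= fg; move: q1 q2 q3; rewrite -fg => q1 q2 q3.
by rewrite (Prop_irrelevance p1 q1) (Prop_irrelevance p2 q2)
  (Prop_irrelevance p3 q3).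
Qed.

Lemma spectrum_act1 (G : groupType) (act : alg_action G A) (chi : spectrum) :
  spectrum_act act 1%g chi = chi.
Proof.
apply: spectrum_eqP => a; rewrite /spectrum_act /=.
by rewrite invg1 aact1.
Qed.

Lemma spectrum_actM (G : groupType) (act : alg_action G A) s t chi :
  spectrum_act act (s * t)%g chi = spectrum_act act s (spectrum_act act t chi).
Proof.
by apply: spectrum_eqP => a; rewrite /spectrum_act /= invgM aactM.
Qed.

Lemma spectrum_act_continuous (G : groupType) (act : alg_action G A) s :
  continuous (spectrum_act act s).
Proof.
apply: continuous_comp_initial => chi.
pose ev (chi : character) : {ptws A -> R[i]^o} := chi.
have ec a : continuous (fun x : spectrum => ev x a).
  move=> x.
  apply: (@continuous_comp spectrum {ptws A -> R[i]^o} R[i]^o ev (fun f => f a)).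
    exact: initial_continuous.
  exact: (@proj_continuous A (fun=> R[i]^o) a).
have FF : Filter (nbhs chi) by exact: nbhs_filter.
have FF' := fmap_filter
  ((ev : spectrum -> {ptws A -> R[i]^o}) \o spectrum_act act s) FF.
apply: (iffRL (@cvg_sup _ _ _ _ _ FF')) => a.
apply: (@continuous_comp_initial {ptws A -> R[i]^o} spectrum R[i]^o
  (fun f => f a)).
exact: (ec (act s^-1%g a)).
Qed.

End Spectrum.

Section Prob.
Variables (R : realType) (G : groupType).

Definition prob_pred : {pred G -> R} := fun xi =>
  `[< (forall x, 0 <= xi x) /\ (\esum_(x in [set: G]) (xi x)%:E = 1)%E >].

(* Probability measures on the discrete group G, as elements of l_1 G. *)
Record prob := Prob { prob_fun :> G -> R; _ : prob_fun \in prob_pred }.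

HB.instance Definition _ := [isSub for prob_fun].
HB.instance Definition _ := [Choice of prob by <:].

Lemma prob_ge0 (xi : prob) x : 0 <= xi x.
Proof. by case: xi => xi /= /asboolP[]. Qed.

Lemma prob_sum (xi : prob) : (\esum_(x in [set: G]) (xi x)%:E = 1)%E.
Proof. by case: xi => xi /= /asboolP[]. Qed.

(* The l_1-norm of xi - zeta. *)
Definition l1dist (xi zeta : prob) : R :=
  fine (\esum_(x in [set: G]) `|xi x - zeta x|%:E)%E.

Lemma l1dist_le2 (xi zeta : prob) :
  (\esum_(x in [set: G]) `|xi x - zeta x|%:E <= 2%:E)%E.
Proof.
have -> : (2%:E = \esum_(x in [set: G]) ((xi x)%:E + (zeta x)%:E) :> \bar R)%E.
  rewrite esumD; [|by move=> x _; rewrite lee_fin prob_ge0..].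
  by rewrite !prob_sum -EFinD.
apply: le_esum => x _; rewrite -EFinD lee_fin.
by rewrite (le_trans (ler_normB _ _))// !ger0_norm ?prob_ge0.
Qed.

Lemma l1dist_fin (xi zeta : prob) :
  ((l1dist xi zeta)%:E = \esum_(x in [set: G]) `|xi x - zeta x|%:E)%E.
Proof.
rewrite /l1dist fineK// ge0_fin_numE; last first.
  by apply: esum_ge0 => x _; rewrite lee_fin.
by rewrite (le_lt_trans (l1dist_le2 _ _))// ltry.
Qed.

Lemma l1distxx xi : l1dist xi xi = 0.
Proof.
by apply: EFin_inj; rewrite l1dist_fin esum1// => x _; rewrite subrr normr0.
Qed.

Lemma l1dist_eq0 xi zeta : l1dist xi zeta = 0 -> xi = zeta.
Proof.
move=> d0; apply/val_inj/funext => x /=; apply/eqP.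
rewrite -subr_eq0 -normr_le0 -lee_fin -[leRHS]/((0 : R)%:E) -d0 l1dist_fin.
apply: esum_ge; exists [set x]; first by split.
by rewrite fsbig_set1.
Qed.

Lemma l1dist_sym xi zeta : l1dist xi zeta = l1dist zeta xi.
Proof. by congr fine; apply: eq_esum => x _; rewrite distrC. Qed.

Lemma l1dist_triangle zeta xi rho :
  l1dist xi rho <= l1dist xi zeta + l1dist zeta rho.
Proof.
rewrite -lee_fin EFinD !l1dist_fin -esumD; [|by move=> x _; rewrite lee_fin..].
by apply: le_esum => x _; rewrite -EFinD lee_fin ler_distD.
Qed.

HB.instance Definition _ :=
  isMetric.Build R prob l1distxx l1dist_eq0 l1dist_sym l1dist_triangle.

Lemma prob_trans_subproof (s : G) (xi : prob) :
  (fun t => xi (s^-1 * t)%g) \in prob_pred.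
Proof.
apply/asboolP; split=> [x|]; first exact: prob_ge0.
rewrite -[RHS](prob_sum xi); apply/esym.
rewrite (reindex_esum [set: G] [set: G] (fun t => (s^-1 * t)%g))//.
split=> //; first by move=> x y _ _; exact: mulgI.
by move=> x _; exists (s * x)%g; rewrite // mulKg.
Qed.

Definition prob_trans (s : G) (xi : prob) : prob :=
  Prob (prob_trans_subproof s xi).

End Prob.

Definition directed (I : Type) (le : I -> I -> Prop) : Prop :=
  [/\ (exists i : I, True), (forall i, le i i),
      (forall i j k, le i j -> le j k -> le i k) &
      (forall i j, exists k, le i k /\ le j k)].

(* The filter of tails, along which nets indexed by I converge. *)
Definition tails (I : Type) (le : I -> I -> Prop) : set_system I :=
  filter_from [set: I] (fun i => [set j | le i j]).

(* l1dist is bounded by 2, so the supremum below is that of a bounded set. *)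
Definition amenable_on_space (R : realType) (G : groupType)
    (K : topologicalType) (act : G -> K -> K) : Prop :=
  exists (I : Type) (le : I -> I -> Prop) (eta : I -> K -> prob R G),
    [/\ directed le,
        (forall i, continuous (eta i)) &
        (forall s : G,
          sup (range (fun x : K =>
            l1dist (eta i (act s x)) (prob_trans s (eta i x))))
          @[i --> tails le] --> (0 : R))].

Definition amenable_action (R : realType) (G : groupType)
    (A : comAlgType R[i]) (act : alg_action G A) : Prop :=
  @amenable_on_space R G (spectrum A) (spectrum_act act).

Definition uniformly_exact (R : realType) (U : free_ultrafilter)
    (G : groupType) : Prop :=
  amenable_action (utranslation R G U).

(* Main.v *)
(* Write |g| for the word length of g and (g|h) for the length of the longest
   common prefix of the reduced words of g and h. Amenability of the action of
   the ultrapower reduces to a property A of the free group that is uniform over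
   all k-tuples S (uniform_property_A): almost S-equivariant maps x |-> eta^x into
   the probability measures on a set of at most N points, with N depending only
   on k and on the error, however long the words in S are.

   Let p_r(x) be the projection of x on the convex hull of the ball of radius r
   of S in the tree. For s in S, |s x| = |x| + |s| - 2 (s^-1|x), so a finitely
   supported measure of positions on the geodesic from 1 to x is almost
   equivariant as soon as it is Folner for the jumps |s| - 2 (s^-1|x), provided
   that these take boundedly many values. For a given J there are two cases.
   - If p_r(x) moves for some r < 4 J, then (s^-1|x) = (s^-1|g) for some g in the
     ball of radius 4 J, and there are boundedly many jumps: average over a grid in
     the group they generate, placed just below p_r(x) for many r.
   - If p_r(x) is constantly equal to P, then P is equivariant and eta^x may depend
     on P alone. Average the uniform measures on the increasing sets A_j of the h such
     that P lies in the translate by h of the hull and d(h, P) is obtained from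
     d(1, P) by at most j jumps and a reflection; |A_j| is polynomial in j.
   The threshold between the cases is averaged over J values, at most one of which
   separates x from s x. *)

Require Import Defs.
From HB Require Import structures.
From mathcomp Require Import all_boot all_order all_algebra.
From mathcomp Require Import all_classical all_reals.
From mathcomp Require Import complex ereal topology normedtype esum exp.
From mathcomp Require Import zify ring lra.

Set Implicit Arguments.
Unset Strict Implicit.
Unset Printing Implicit Defensive.

Import Order.TTheory GRing.Theory Num.Theory.
Import numFieldNormedType.Exports.

(** * Common prefixes of words *)

Section CommonPrefix.
Variable A : eqType.
Implicit Types s t u : seq A.

Fixpoint lcp s t : nat :=
  match s, t with
  | a :: s', b :: t' => if a == b then (lcp s' t').+1 else 0
  | _, _ => 0
  end.

Lemma lcpC s t : lcp s t = lcp t s.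
Proof.
elim: s t => [|a s IH] [|b t] //=; rewrite eq_sym.
by case: eqP => // _; rewrite IH.
Qed.

Lemma leq_lcpP n s t :
  reflect [/\ n <= size s, n <= size t & take n s = take n t] (n <= lcp s t).
Proof.
elim: n s t => [|n IH] [|a s] [|b t]; apply: (iffP idP) => //=;
  do ?by [case|split].
- by case: eqP => // -> /IH[? ? ->].
- by rewrite !ltnS => -[? ? [-> ?]]; rewrite eqxx ltnS; apply/IH.
Qed.

Lemma lcp_size s t : lcp s t <= size s.
Proof. by have /leq_lcpP[] := leqnn (lcp s t). Qed.

Lemma take_lcp n s t : n <= lcp s t -> take n s = take n t.
Proof. by case/leq_lcpP. Qed.

Lemma lcp_take n s t : lcp (take n s) t = minn n (lcp s t).
Proof.
elim: s t n => [|a s IH] [|b t] [|n] //=; rewrite ?min0n ?minn0 //.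
by case: eqP => // _; rewrite IH minnSS.
Qed.

Lemma drop_lcp s t a b s' t' :
  drop (lcp s t) s = a :: s' -> drop (lcp s t) t = b :: t' -> a != b.
Proof.
elim: s t => [|c s IH] [|d t] //=; case: eqP => [_|cd] /=; first exact: IH.
by case=> <- _ [<- _]; apply/eqP.
Qed.

(* 0-hyperbolicity of the tree of words. *)
Lemma lcp_min s t u : lcp s u < lcp t u -> lcp s t = lcp s u.
Proof.
elim: s t u => [|a s IH] [|b t] [|c u] //=.
case: (eqVneq b c) => // <-; case: eqP => // _; rewrite ltnS => h.
by rewrite (IH _ _ h).
Qed.

End CommonPrefix.

(** * Permutation groups *)

Section Bijections.
Variable T : Type.

(** The inverse is stored as data so that group inversion just swaps the two maps. It is determined
    by the function, so equality remains pointwise ([bij_eqP]). *)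
Record bij := Bij {
  bij_fun :> T -> T;
  bij_inv : T -> T;
  bij_funK : cancel bij_fun bij_inv;
  bij_invK : cancel bij_inv bij_fun }.

HB.instance Definition _ := gen_eqMixin bij.
HB.instance Definition _ := gen_choiceMixin bij.

Lemma bij_eqP (f g : bij) : (forall x, f x = g x) -> f = g.
Proof.
case: f g => f f' fK f'K [g g' gK g'K] /= /funext fg; move: gK g'K.
rewrite -{}fg => gK g'K.
have fg' : f' = g' by apply/funext => x; rewrite -{1}(g'K x) fK.
move: gK g'K; rewrite -{}fg' => gK g'K.
by rewrite (Prop_irrelevance fK gK) (Prop_irrelevance f'K g'K).
Qed.

Definition bij1 := @Bij id id (fun=> erefl) (fun=> erefl).
Definition bijV (f : bij) := Bij (bij_invK f) (bij_funK f).
Definition bijM (f g : bij) :=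
  Bij (can_comp (bij_funK f) (bij_funK g)) (can_comp (bij_invK g) (bij_invK f)).

Lemma bijA : associative bijM.
Proof. by move=> f g h; apply: bij_eqP. Qed.
Lemma bij1M : left_id bij1 bijM.
Proof. by move=> f; apply: bij_eqP. Qed.
Lemma bijM1 : right_id bij1 bijM.
Proof. by move=> f; apply: bij_eqP. Qed.
Lemma bijVM : left_inverse bij1 bijV bijM.
Proof. by move=> f; apply: bij_eqP => x /=; rewrite bij_funK. Qed.
Lemma bijMV : right_inverse bij1 bijV bijM.
Proof. by move=> f; apply: bij_eqP => x /=; rewrite bij_invK. Qed.

HB.instance Definition _ := isGroup.Build bij bijA bij1M bijM1 bijVM bijMV.

Lemma bijME (f g : bij) x : (f * g)%g x = f (g x).
Proof. by []. Qed.

End Bijections.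

Definition bij_prod T1 T2 (f : bij T1) (g : bij T2) : bij (T1 * T2).
Proof.
exists (fun p => (f p.1, g p.2)) (fun p => (bij_inv f p.1, bij_inv g p.2)).
- by case=> a b /=; rewrite !bij_funK.
- by case=> a b /=; rewrite !bij_invK.
Defined.

Section GroupBij.
Variable G : groupType.
Local Open Scope group_scope.

Definition lmul_bij (g : G) : bij G := Bij (mulKg g) (mulVKg g).

Definition conj_bij (g : G) : bij G.
Proof.
exists (fun b => g * b * g^-1) (fun b => g^-1 * b * g).
- by move=> b; rewrite !mulgA mulVg mul1g -mulgA mulVg mulg1.
- by move=> b; rewrite !mulgA mulgV mul1g -mulgA mulgV mulg1.
Defined.

End GroupBij.

(** * Reduced words *)

Section ReducedWords.
Variable X : eqType.

Definition letter : Type := (X * bool)%type.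
HB.instance Definition _ := Equality.on letter.

Definition flip (a : letter) : letter := (a.1, ~~ a.2).

Lemma flipK : involutive flip.
Proof. by case=> x b; rewrite /flip /= negbK. Qed.

Definition reduced (s : seq letter) := sorted (fun a b : letter => b != flip a) s.

Definition push (a : letter) (s : seq letter) : seq letter :=
  if s is b :: s' then if b == flip a then s' else a :: s else [:: a].

Lemma push_reduced a s : reduced s -> reduced (push a s).
Proof.
case: s => //= b s rs; case: ifPn => [_|/= ->]; last by [].
by case: s rs => //= c s /andP[].
Qed.

Lemma push_flip a s : reduced s -> push (flip a) (push a s) = s.
Proof.
case: s => [|b s] /=; first by rewrite flipK eqxx.
case: ifPn => [/eqP-> | _] rs /=; last by rewrite flipK eqxx.
by case: s rs => //= c s /andP[/negPf ->].
Qed.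

Lemma push_cons a s : reduced (a :: s) -> push a s = a :: s.
Proof. by case: s => //= b s /andP[/negPf->]. Qed.

Definition rword := {s : seq letter | reduced s}.

Definition rpush (a : letter) (v : rword) : rword :=
  exist _ (push a (val v)) (push_reduced a (valP v)).

Lemma rpushK a : cancel (rpush a) (rpush (flip a)).
Proof. by move=> v; apply: val_inj; rewrite /= push_flip //; exact: valP. Qed.

(** The image of a generator in van der Waerden's action on reduced words. *)
Definition rpush_bij (a : letter) : bij rword.
Proof.
exists (rpush a) (rpush (flip a)); first exact: rpushK.
by move=> v; rewrite -{1}(flipK a) rpushK.
Defined.

Definition winv (s : seq letter) := rev (map flip s).

Lemma size_winv s : size (winv s) = size s.
Proof. by rewrite size_rev size_map. Qed.

Lemma winv_cat s t : winv (s ++ t) = winv t ++ winv s.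
Proof. by rewrite /winv map_cat rev_cat. Qed.

Lemma winv_reduced s : reduced s -> reduced (winv s).
Proof.
rewrite /reduced /winv rev_sorted sorted_map; apply: sub_sorted => a b /=.
rewrite /= flipK; by apply: contra => /eqP ->.
Qed.

Lemma take_reduced n s : reduced s -> reduced (take n s).
Proof. exact: take_sorted. Qed.

(** [winv s] ends in the flip of the first letter of [s], so no cancellation occurs at the junction
    when the first letters differ. *)
Lemma reduced_winv_cat s t : reduced s -> reduced t ->
  (forall a b s' t', s = a :: s' -> t = b :: t' -> a != b) ->
  reduced (winv s ++ t).
Proof.
case: s => [//|a s] rs; case: t => [|b t] rt ab.
  by rewrite cats0 winv_reduced.
have /winv_reduced := rs; rewrite /winv /= rev_cons /reduced => rs'.
rewrite cat_rcons.
case: (rev _) rs' => [|c u] /=; first by rewrite flipK eq_sym (ab a b s t) // rt.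
rewrite rcons_path cat_path /= => /andP[-> ->] /=.
by rewrite flipK eq_sym (ab a b s t).
Qed.

End ReducedWords.

Section FreeWords.
Variables (G : groupType) (X : choiceType) (i : X -> G).
Hypothesis Gfree : free_on i.
Local Open Scope group_scope.

Definition evl (a : letter X) : G := if a.2 then (i a.1)^-1 else i a.1.

Lemma evl_flip a : evl (flip a) = (evl a)^-1.
Proof. by case: a => x [] /=; rewrite /evl /= ?invgK. Qed.

Definition ev (s : seq (letter X)) : G := foldr (fun a g => evl a * g) 1 s.

Lemma ev_cat s t : ev (s ++ t) = ev s * ev t.
Proof. by elim: s => [|a s IH] /=; rewrite ?mul1g // IH mulgA. Qed.

Lemma ev_winv s : ev (winv s) = (ev s)^-1.
Proof.
elim: s => [|a s IH] /=; first by rewrite invg1.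
by rewrite /winv /= rev_cons -cats1 ev_cat -/(winv s) IH /= mulg1 evl_flip invgM.
Qed.

Lemma ev_push a s : ev (push a s) = evl a * ev s.
Proof.
case: s => [|b s] //=; case: eqP => //= ->.
by rewrite evl_flip mulgA mulgV mul1g.
Qed.

(** [free_on] does not say that the image of [i] generates; uniqueness in the universal property
    replaces induction on generators. *)
Lemma free_hom_ext (H : groupType) (f g : G -> H) :
  {morph f : x y / x * y} -> {morph g : x y / x * y} ->
  (forall x, f (i x) = g (i x)) -> f = g.
Proof.
move=> fM gM fg; have [h [_ hU]] := Gfree (f \o i).
rewrite -(hU f) // -(hU g) //; split => //.
by apply/funext => x /=; rewrite fg.
Qed.

(** Van der Waerden's trick: the universal property makes [G] act on reduced words, and the word of
    g is g applied to the empty word. Equivariance of [ev] shows that this word evaluates to g;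
    induction on a reduced word gives the converse. *)
Lemma free_words : exists w : G -> seq (letter X),
  (forall g, reduced (w g) /\ ev (w g) = g) /\
  (forall s, reduced s -> w (ev s) = s).
Proof.
pose H : groupType := bij (rword X).
have [Phi [[PhiM PhiE] _]] := Gfree (fun x => rpush_bij (x, false) : H).
have Phi1 : Phi 1 = 1.
  by apply: (@mulgI _ (Phi 1)); rewrite -PhiM !mulg1.
have PhiV g : Phi g^-1 = (Phi g)^-1.
  by apply: (@mulgI _ (Phi g)); rewrite -PhiM !mulgV.
have Phil a : Phi (evl a) = rpush_bij a.
  case: a => x b; rewrite /evl /=.
  have e : Phi (i x) = rpush_bij (x, false) by rewrite -[LHS]/((Phi \o i) x) PhiE.
  by case: b; rewrite ?PhiV e //; apply: bij_eqP.
pose evr (v : rword X) := ev (val v).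
(* Conjugating the diagonal action by tau turns the equivariance of ev into
   the equality of two homomorphisms that agree on the generators. *)
have key g v : evr (Phi g v) = g * evr v.
  pose K : groupType := bij (rword X * G).
  pose tau : K := @Bij (rword X * G) (fun p => (p.1, p.2 * (evr p.1)^-1))
    (fun p => (p.1, p.2 * evr p.1))
    (fun p => ltac:(by case: p => a b /=; rewrite -mulgA mulVg mulg1))
    (fun p => ltac:(by case: p => a b /=; rewrite -mulgA mulgV mulg1)).
  pose D g : K := bij_prod (Phi g) (lmul_bij g).
  have DM : {morph D : x y / x * y}.
    by move=> x y; apply: bij_eqP => -[u b] /=; rewrite PhiM -mulgA.
  pose f1 g : K := tau * D g * tau^-1.
  pose f2 g : K := bij_prod (Phi g) (conj_bij g).
  have f12 : f1 = f2.
    apply: free_hom_ext => [x y|x y|x].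
    - by rewrite /f1 DM !mulgA mulgVK.
    - apply: bij_eqP => -[u b] /=.
      by rewrite PhiM invgM !mulgA.
    - apply: bij_eqP => -[u b] /=.
      rewrite -[i x]/(evl (x, false)) Phil /= /evr /= ev_push.
      by rewrite invgM !mulgA mulgK.
  have := congr1 (fun f : G -> K => (f g (v, 1)).2) f12.
  rewrite /= mul1g mulg1 => /(congr1 (fun z => g^-1 * z)).
  rewrite !mulgA mulVg !mul1g => /(congr1 (fun z => g * z * evr (Phi g v))).
  by rewrite mulgV mul1g !mulgA mulgVK => ->.
pose nil : rword X := exist _ [::] isT.
exists (fun g => val (Phi g nil)); split=> [g|s].
  by split; [exact: valP|rewrite -/(evr _) key mulg1].
elim: s => [|a s IH] rs /=; first by rewrite Phi1.
rewrite PhiM bijME Phil /= IH ?push_cons //.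
exact: path_sorted rs.
Qed.

End FreeWords.

(* What is used of a free group: elements have reduced words, and the product
   s x cancels exactly the common prefix of s^-1 and x. *)
Record word_length (G : groupType) := WordLength {
  alphabet : eqType;
  word : G -> seq alphabet;
  prefix_of : G -> nat -> G;
  word_inj : injective word;
  word_prefix_of : forall g n, word (prefix_of g n) = take n (word g);
  size_wordV : forall g, size (word g^-1%g) = size (word g);
  wordM : forall s x, let c := lcp (word s^-1%g) (word x) in
    word (s * x)%g = take (size (word s) - c) (word s) ++ drop c (word x) }.

Lemma free_group_word_length (G : groupType) :
  free_group G -> inhabited (word_length G).
Proof.
move=> [X [i Gfree]].
(* [X] is a bare type; [{classic X}] gives it the equality and choice that words need. *)
pose j : {classic X} -> G := i.
have [w [wP wE]] := @free_words G {classic X} j Gfree.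
have wr g : reduced (w g) by case: (wP g).
have ewK g : ev j (w g) = g by case: (wP g).
have wV g : w g^-1%g = winv (w g).
  by rewrite -[in LHS](ewK g) -ev_winv wE // winv_reduced.
constructor; apply: (@WordLength G _ w (fun g n => ev j (take n (w g)))).
- by move=> x y /(congr1 (ev j)); rewrite !ewK.
- by move=> g n; rewrite wE // take_reduced.
- by move=> g; rewrite wV size_winv.
- move=> s x; set c := lcp _ _ => /=.
  pose a := drop c (w s^-1%g); pose b := drop c (w x).
  have ws : w s = winv a ++ winv (take c (w s^-1%g)).
    by rewrite -winv_cat cat_take_drop -wV invgK.
  have -> : take (size (w s) - c) (w s) = winv a.
    rewrite {2}ws take_size_cat // size_winv size_drop wV size_winv.
    by [].
  have red : reduced (winv a ++ b).
    apply: reduced_winv_cat; [exact: drop_sorted (wr _)..|].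
    by move=> p q s' t'; exact: drop_lcp.
  rewrite -[RHS]wE //; congr w.
  have xE : x = (ev j (take c (w s^-1)) * ev j (drop c (w x)))%g.
    by rewrite (take_lcp (leqnn c)) -ev_cat cat_take_drop.
  by rewrite ev_cat ev_winv -{1}(ewK s) ws ev_cat !ev_winv {1}xE -mulgA mulKg.
Qed.

(** * Geometry of balls in the tree *)

Section Tree.
Variables (G : groupType) (W : word_length G).
Local Notation pre := (prefix_of W).
Implicit Types g h s x : G.

Definition len g := size (word W g).
Definition gp g h := lcp (word W g) (word W h).

Lemma gpC g h : gp g h = gp h g.
Proof. exact: lcpC. Qed.

Lemma gp_len g h : gp g h <= len g.
Proof. exact: lcp_size. Qed.

Lemma gp_lenr g h : gp g h <= len h.
Proof. by rewrite gpC gp_len. Qed.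

Lemma lenV g : len g^-1 = len g.
Proof. exact: size_wordV. Qed.

Lemma len_pre x n : len (pre x n) = minn n (len x).
Proof. by rewrite /len word_prefix_of size_take_min. Qed.

Lemma gp_pre g x n : gp (pre x n) g = minn n (gp x g).
Proof. by rewrite /gp word_prefix_of lcp_take. Qed.

Lemma lenM s x :
  len (s * x) = len s - gp s^-1 x + (len x - gp s^-1 x).
Proof.
by rewrite /len wordM size_cat size_drop size_takel ?leq_subr.
Qed.

(** [lenM] for (s, x) and for (s^-1, s x) gives two equations between the same lengths; together
    they determine the prefix. *)
Lemma gpM s x : gp s (s * x) = len s - gp s^-1 x.
Proof.
have h1 := lenM s x; have := lenM s^-1%g (s * x)%g.
rewrite mulKg invgK lenV => h2.
have := gp_len s^-1%g x; have := gp_lenr s^-1%g x.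
have := gp_len s (s * x)%g; have := gp_lenr s (s * x)%g.
rewrite lenV; lia.
Qed.

(** Beyond the point where it branches from s^-1, the geodesic from 1 to x is mapped by s into the
    geodesic from 1 to s x. The new length is the distance from s^-1 to [pre x n], measured through
    the branch point. *)
Lemma mul_pre s x n : gp s^-1 x <= n ->
  (s * pre x n)%g = pre (s * x) (n - gp s^-1 x + (len s - gp s^-1 x)).
Proof.
move=> cn; apply: (@word_inj _ W); rewrite wordM !word_prefix_of wordM.
rewrite [lcp _ _]lcpC lcp_take [lcp (word W x) _]lcpC (minn_idPr cn).
rewrite -/(gp s^-1 x); set c := gp _ _.
have st : size (take (size (word W s) - c) (word W s)) = len s - c.
  by rewrite size_takel ?leq_subr.
rewrite take_cat st ltnNge leq_addl /= addnK.
by rewrite take_drop subnK.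
Qed.

Lemma pre_gp g x n : n <= gp g x -> pre g n = pre x n.
Proof.
by move=> h; apply: (@word_inj _ W); rewrite !word_prefix_of; exact: take_lcp h.
Qed.

Lemma gp_ge g x n :
  n <= len g -> n <= len x -> pre g n = pre x n -> n <= gp g x.
Proof.
move=> ng nx /(congr1 (word W)); rewrite !word_prefix_of => e.
by apply/leq_lcpP.
Qed.

Lemma gp_min g h x : gp g x < gp h x -> gp g h = gp g x.
Proof. exact: lcp_min. Qed.

End Tree.

Lemma bigmax_seq_ex (T : eqType) (F : T -> nat) b l :
  exists2 h, h \in b :: l & \max_(h <- b :: l) F h = F h.
Proof.
elim: l b => [|c l IH] b; first by exists b; rewrite ?mem_seq1 // big_seq1.
rewrite big_cons; have [h hl ->] := IH c.
have [le|lt] := leqP (F b) (F h); first by exists h => //; rewrite inE hl orbT.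
by exists b => //; rewrite inE eqxx.
Qed.

Section Ball.
Variables (G : groupType) (W : word_length G) (S : seq G).
Hypothesis S1 : 1%g \in S.
Hypothesis SV : forall s, s \in S -> s^-1%g \in S.
Local Notation pre := (prefix_of W).
Local Notation len := (len W).
Local Notation gp := (gp W).
Implicit Types g h s x : G.

Fixpoint ball r : seq G :=
  if r is r'.+1 then [seq (s * h)%g | s <- S, h <- ball r'] else [:: 1%g].

Lemma size_ball r : size (ball r) = size S ^ r.
Proof. by elim: r => //= r IH; rewrite size_allpairs IH expnS. Qed.

Lemma ball_mul s h r : s \in S -> h \in ball r -> (s * h)%g \in ball r.+1.
Proof. by move=> sS hr; apply/allpairsP; exists (s, h). Qed.

Lemma ball_mono r q : r <= q -> {subset ball r <= ball q}.
Proof.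
move=> /subnK <-; elim: (q - r) => // n IH h /IH hn.
by rewrite -(mul1g h) addSn ball_mul.
Qed.

Lemma mem_ball s r : 0 < r -> s \in S -> s \in ball r.
Proof.
move=> r0 sS; apply: (ball_mono r0).
by rewrite -(mulg1 s) ball_mul //= mem_seq1.
Qed.

Lemma ball1 r : 1%g \in ball r.
Proof. by apply: (@ball_mono 0) => //; rewrite mem_seq1. Qed.

(* The distance from 1 to the projection of x on the convex hull of the ball. *)
Definition ell r x := \max_(h <- ball r) gp h x.

Definition hproj r x := pre x (ell r x).

Lemma ell_ge r h x : h \in ball r -> gp h x <= ell r x.
Proof. by move=> hr; rewrite /ell (big_rem h) //= leq_maxl. Qed.

Lemma ell_ex r x : exists2 h, h \in ball r & ell r x = gp h x.
Proof.
by rewrite /ell; case: (ball r) (ball1 r) => [//|b l] _; exact: bigmax_seq_ex.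
Qed.

Lemma ell_mono r q x : r <= q -> ell r x <= ell q x.
Proof.
by move=> rq; have [h /(ball_mono rq) hq ->] := ell_ex r x; exact: ell_ge.
Qed.

Lemma ell_len r x : ell r x <= len x.
Proof. by have [h _ ->] := ell_ex r x; exact: gp_lenr. Qed.

Lemma gp_ell s r x : s \in S -> 0 < r -> gp s^-1 x <= ell r x.
Proof. by move=> sS r0; rewrite ell_ge ?mem_ball // SV. Qed.

(** If x leaves the hull at its branch point from s^-1, then s itself realizes the bound. Otherwise
    a maximizing h branches from s^-1 where x does, and s h follows s x up to the translated
    projection. The factor s costs one unit of radius. *)
Lemma ell_shift s r x : s \in S -> 0 < r ->
  ell r x - gp s^-1 x + (len s - gp s^-1 x) <= ell r.+1 (s * x).
Proof.
move=> sS r0; have := gp_ell x sS r0; set c := gp _ _.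
have [h hr ->] := ell_ex r x; rewrite leq_eqVlt => /predU1P[<-|cd].
  rewrite subnn add0n; apply: leq_trans (ell_ge _ (mem_ball (ltn0Sn r) sS)).
  by rewrite gpM.
apply: leq_trans (ell_ge _ (ball_mul sS hr)).
have ch : gp s^-1 h = c by exact: gp_min cd.
have hd := gp_len W h x; have xd := gp_lenr W h x.
apply: gp_ge; rewrite ?lenM ?ch -/c; try lia.
rewrite -{1}ch -[X in _ + (_ - X)]ch -mul_pre ?ch ?(ltnW cd) //.
by rewrite -mul_pre ?(ltnW cd) // (pre_gp (leqnn _)).
Qed.

Lemma ell_shiftV s r x : s \in S -> 0 < r ->
  ell r (s * x) <= ell r.+1 x - gp s^-1 x + (len s - gp s^-1 x).
Proof.
move=> sS r0; have := ell_shift (s * x) (SV sS) r0.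
rewrite mulKg invgK gpM lenV => h.
have := gp_ell (s * x) (SV sS) r0; rewrite invgK gpM.
have := gp_ell x sS (ltn0Sn r); have := gp_len W s^-1%g x; rewrite lenV.
lia.
Qed.

(** [ell_shift] from radius r - 1 and [ell_shiftV] from radius r + 1 enclose [ell r (s * x)] between
    two values that coincide by hypothesis. *)
Lemma hproj_shift s r x : s \in S -> 1 < r -> ell r.-1 x = ell r.+1 x ->
  hproj r (s * x) = (s * hproj r x)%g.
Proof.
move=> sS r1 e; have e1 : ell r x = ell r.+1 x.
  apply/eqP; rewrite eqn_leq ell_mono //= -e ell_mono //; lia.
have r0 : 0 < r.-1 by lia.
rewrite /hproj mul_pre; last by apply: gp_ell => //; lia.
congr (pre _ _); apply/eqP; rewrite eqn_leq e1 ell_shiftV //=; last by lia.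
by have := ell_shift x sS r0; rewrite e prednK //; lia.
Qed.

(* x does not leave the hull of the ball of radius i before that of radius
   4 * J - i. *)
Definition stuck J i x := ell i x == ell (4 * J - i) x.

Lemma stuck_mono J i x : i < 2 * J -> stuck J i x -> stuck J i.+1 x.
Proof.
move=> iJ /eqP e; apply/eqP.
have h1 : ell i x <= ell i.+1 x by apply: ell_mono.
have h2 : ell i.+1 x <= ell (4 * J - i.+1) x by apply: ell_mono; lia.
have h3 : ell (4 * J - i.+1) x <= ell (4 * J - i) x by apply: ell_mono; lia.
lia.
Qed.

(** Translation costs one unit of radius at each end, exactly what the interval [i, 4 J - i] loses
    when i grows by 1. *)
Lemma stuck_shift s J i x : s \in S -> 0 < i -> i < 2 * J ->
  stuck J i x -> stuck J i.+1 (s * x).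
Proof.
move=> sS i0 iJ /eqP e; apply/eqP/eqP; rewrite eqn_leq ell_mono; last by lia.
apply: leq_trans (ell_shift x sS i0); rewrite e.
have -> : 4 * J - i = (4 * J - i.+1).+1 by lia.
by apply: ell_shiftV => //; lia.
Qed.

Lemma stuck_shiftV s J i x : s \in S -> 0 < i -> i < 2 * J ->
  stuck J i (s * x) -> stuck J i.+1 x.
Proof.
by move=> sS i0 iJ /(stuck_shift (SV sS) i0 iJ); rewrite mulKg.
Qed.

(** As i < 2 J, the radii 2 J - 1 and 2 J + 1 lie in [i, 4 J - i], where [ell] is constant at x. *)
Lemma stuck_hproj s J i x : s \in S -> 0 < i -> i < 2 * J ->
  stuck J i x -> hproj (2 * J) (s * x) = (s * hproj (2 * J) x)%g.
Proof.
move=> sS i0 iJ /eqP e; apply: hproj_shift => //; first by lia.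
apply/eqP; rewrite eqn_leq ell_mono ?(leq_trans (leq_pred _)) //=.
apply: (@leq_trans (ell i x)); last by apply: ell_mono; lia.
by rewrite e; apply: ell_mono; lia.
Qed.

(** Some g in the larger ball follows x strictly longer than s^-1 does, so s^-1 branches from g
    where it branches from x. *)
Lemma not_stuck s J i x : s \in S -> 0 < i -> ~~ stuck J i x -> i < 2 * J ->
  exists2 g, g \in ball (4 * J) & gp s^-1 x = gp s^-1 g.
Proof.
move=> sS i0 ns iJ.
have lt : ell i x < ell (4 * J - i) x by rewrite ltn_neqAle ns ell_mono //; lia.
have [g gB e] := ell_ex (4 * J - i) x.
exists g; first by apply: ball_mono gB; lia.
rewrite (@gp_min _ _ s^-1%g g x) // -e.
exact: leq_ltn_trans (gp_ell x sS i0) lt.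
Qed.

End Ball.

Local Open Scope ring_scope.

(** * Averages *)

Section Average.
Variables (R : realType) (T : eqType).
Implicit Types (l : seq T) (phi : T -> R).

(** A list stands for the uniform measure on its entries, counted with multiplicity; [avg] is its
    integral and [mass] its density. *)
Definition avg l phi : R := (\sum_(t <- l) phi t) / (size l)%:R.

Definition mass l t : R := (count_mem t l)%:R / (size l)%:R.

Lemma mass_ge0 l t : 0 <= mass l t.
Proof. by rewrite divr_ge0. Qed.

Lemma sum_mass (F : seq T) l phi : uniq F -> {subset l <= F} ->
  \sum_(t <- F) mass l t * phi t = avg l phi.
Proof.
move=> uF lF; rewrite /avg mulr_suml.
transitivity (\sum_(t <- F) \sum_(u <- l | u == t) phi u / (size l)%:R).
  apply: eq_bigr => t _; rewrite (eq_bigr (fun=> phi t / (size l)%:R)).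
    rewrite big_const_seq iter_addr_0 -[RHS]mulr_natl /mass.
    by rewrite -mulrA [_^-1 * _]mulrC.
  by move=> u /eqP ->.
rewrite (exchange_big_dep xpredT) //= big_seq [RHS]big_seq.
apply: eq_bigr => u /lF uFF.
rewrite -big_filter (_ : [seq t <- F | u == t] = [:: u]) ?big_seq1 //.
rewrite (eq_filter (a2 := pred1 u)) => [|t]; last exact: eq_sym.
exact: filter_pred1_uniq.
Qed.

Lemma avgD l phi psi : avg l (fun t => phi t + psi t) = avg l phi + avg l psi.
Proof. by rewrite /avg big_split mulrDl. Qed.

Lemma avg_const l c : (0 < size l)%N -> avg l (fun=> c) = c.
Proof.
move=> l0; rewrite /avg big_const_seq count_predT iter_addr_0 -[c *+ _]mulr_natr.
by rewrite mulfK // pnatr_eq0 -lt0n.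
Qed.

Lemma avgN l phi : avg l (fun t => - phi t) = - avg l phi.
Proof. by rewrite /avg sumrN mulNr. Qed.

Lemma avg_sub_ge (A P : seq T) (b : nat) psi : uniq A -> uniq P ->
  {subset A <= P} -> (size P <= b)%N -> (0 < size P)%N ->
  (forall t, 0 <= psi t) -> (\sum_(t <- A) psi t) / b%:R <= avg P psi.
Proof.
move=> uA uP AP Pb P0 psi0.
have AleP : \sum_(t <- A) psi t <= \sum_(t <- P) psi t.
  rewrite [leRHS](bigID (mem A)) /= -[leLHS]addr0.
  apply: lerD; last by apply: sumr_ge0.
  rewrite -[leRHS]big_filter (perm_big [seq t <- P | t \in A]) //=.
  apply: uniq_perm => //; first exact: filter_uniq.
  by move=> t; rewrite mem_filter; case: (boolP (t \in A)) => // /AP ->.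
apply: ler_pM; rewrite ?sumr_ge0 ?invr_ge0 // lef_pV2 ?posrE ?ltr0n ?ler_nat //.
exact: leq_trans Pb.
Qed.

(* Splitting phi as 1 - (1 - phi) on P and as (1 + phi) - 1 on Q, both
   corrections are bounded below by their sums over A. *)
Lemma avg_sandwich (A B P Q : seq T) phi :
  uniq A -> uniq B -> uniq P -> uniq Q -> (0 < size A)%N ->
  {subset A <= P} -> {subset A <= Q} ->
  {subset P <= B} -> {subset Q <= B} -> (forall t, `|phi t| <= 1) ->
  avg P phi - avg Q phi <= 2 * (1 - (size A)%:R / (size B)%:R).
Proof.
move=> uA uB uP uQ A0 AP AQ PB QB phi1.
have sP : (0 < size P)%N by apply: leq_trans (uniq_leq_size uA AP).
have sQ : (0 < size Q)%N by apply: leq_trans (uniq_leq_size uA AQ).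
have h1 t : 0 <= 1 + phi t by have := phi1 t; rewrite ler_norml; lra.
have h2 t : 0 <= 1 + - phi t by have := phi1 t; rewrite ler_norml; lra.
have := avg_sub_ge uA uQ AQ (uniq_leq_size uQ QB) sQ h1.
have := avg_sub_ge uA uP AP (uniq_leq_size uP PB) sP h2.
rewrite !avgD !avg_const // avgN !big_split /= !sumrN.
rewrite !big_const_seq !count_predT !iter_addr_0 !mulrDl mulNr.
set a := _ / _; set b := _ / _; lra.
Qed.

Lemma avg_le2 (P Q : seq T) phi psi : (0 < size P)%N -> (0 < size Q)%N ->
  (forall t, `|phi t| <= 1) -> (forall t, `|psi t| <= 1) ->
  avg P phi - avg Q psi <= 2.
Proof.
have avg1 l f : (0 < size l)%N -> (forall t, `|f t| <= 1) -> `|avg l f| <= 1.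
  move=> l0 f1; rewrite /avg normrM normfV normr_nat ler_pdivrMr ?ltr0n //.
  rewrite mul1r (le_trans (ler_norm_sum _ _ _)) //.
  rewrite (le_trans (ler_sum _ (fun t _ => f1 t))) //.
  by rewrite big_const_seq count_predT iter_addr_0.
move=> P0 Q0 /(avg1 _ _ P0) h1 /(avg1 _ _ Q0) h2.
by move: h1 h2; rewrite !ler_norml; lra.
Qed.

Lemma avg_map (I : Type) (f : I -> T) (r : seq I) phi :
  avg (map f r) phi = (\sum_(i <- r) phi (f i)) / (size r)%:R.
Proof. by rewrite /avg big_map size_map. Qed.

(** After reindexing the first average by [tau] the good terms cancel, and each bad one costs at
    most 2. *)
Lemma avg_image (I : finType) (f g : I -> T) (tau : I -> I) (bad : pred I) phi psi :
  bijective tau -> (forall i, ~~ bad i -> phi (f (tau i)) = psi (g i)) ->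
  (forall t, `|phi t| <= 1) -> (forall t, `|psi t| <= 1) ->
  avg (map f (enum I)) phi - avg (map g (enum I)) psi <=
  2 * (\sum_i (bad i)%:R) / #|I|%:R.
Proof.
move=> btau good phi1 psi1; rewrite !avg_map -cardE -mulrBl.
rewrite ler_wpM2r ?invr_ge0 // !big_enum /= (reindex tau) /=; last first.
  exact: onW_bij.
rewrite -sumrB mulr_sumr ler_sum // => i _.
have [b|/good ->] := boolP (bad i); last by rewrite subrr mulr0.
by rewrite mulr1; have := phi1 (f (tau i)); have := psi1 (g i);
  rewrite !ler_norml; lra.
Qed.

End Average.

(** * Telescoping logarithms and polynomial growth *)

Section Telescope.
Variable R : realType.

Lemma sum_shift2 (f : nat -> R) n :
  \sum_(0 <= j < n) (f j.+2 - f j) = f n.+1 + f n - f 1%N - f 0%N.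
Proof.
elim: n => [|n IH]; first by rewrite big_geq //; ring.
by rewrite big_nat_recr //= IH; ring.
Qed.

(* 1 - u <= - ln u, and the logarithms telescope. *)
Lemma sum_ratio (a : nat -> nat) (b n : nat) :
  (forall j, (j <= n.+1)%N -> (0 < a j <= b)%N) ->
  \sum_(0 <= j < n) (1 - (a j)%:R / (a j.+2)%:R) <= 2 * ln (b%:R : R).
Proof.
move=> ab; have a0 j : (j <= n.+1)%N -> 0 < (a j)%:R :> R.
  by move=> /ab/andP[]; rewrite ltr0n.
have lnb j : (j <= n.+1)%N -> ln (a j)%:R <= ln (b%:R : R).
  move=> /ab/andP[j0 jb]; rewrite ler_ln ?posrE ?ler_nat ?ltr0n //.
  exact: leq_trans jb.
have ln0 j : (j <= n.+1)%N -> 0 <= ln ((a j)%:R : R).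
  by move=> /ab/andP[j0 _]; rewrite ln_ge0 // ler1n.
apply: (@le_trans _ _ (\sum_(0 <= j < n) (ln ((a j.+2)%:R : R) - ln (a j)%:R))).
  rewrite big_nat [leRHS]big_nat; apply: ler_sum => j /andP[_ jn].
  have [a0j a0j2] : 0 < (a j)%:R :> R /\ 0 < (a j.+2)%:R :> R.
    by split; apply: a0; lia.
  set u := _ / _.
  have u0 : 0 < u by rewrite divr_gt0.
  have := @le_ln1Dx R (u - 1); rewrite [1 + _]addrC subrK ltrBDr.
  have -> : ln u = ln (a j)%:R - ln (a j.+2)%:R by rewrite ln_div ?posrE.
  by rewrite addrC subrr => /(_ u0); lra.
rewrite (sum_shift2 (fun j => ln (a j)%:R)).
have := lnb n (leqnSn n); have := lnb n.+1 (leqnn _).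
have := ln0 0%N (leq0n _); have := ln0 1%N (ltn0Sn n); lra.
Qed.

(** With n = k ^ 2, the crude bound ln y <= y applied to y = 2 k + 1 bounds the left side linearly
    in k, while the right side is quadratic. *)
Lemma ln_poly_small (b N : nat) (e : R) : 0 < e ->
  exists2 n, (0 < n)%N & 2 * ln ((b * (2 * n + 3) ^ N)%N%:R) <= e * n%:R.
Proof.
move=> e0; have [k kP] : exists k : nat, 2 * (b + 6 * N)%N%:R / e < k%:R.
  exists (Num.bound (2 * (b + 6 * N)%N%:R / e)); apply: archi_boundP.
  by rewrite divr_ge0 ?mulr_ge0 // ltW.
have k0 : (0 < k)%N.
  by rewrite -(ltr0n R); apply: le_lt_trans kP; rewrite divr_ge0 ?mulr_ge0 // ltW.
exists (k ^ 2)%N; first by rewrite expn_gt0 k0.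
(* By convention [ln 0] is 0. *)
have [->|b0] := posnP b; first by rewrite mul0n ln0 // mulr0 mulr_ge0 // ltW.
have le1 : (2 * k ^ 2 + 3 <= (2 * k + 1) ^ 2)%N by nia.
have lnb : ln (b%:R : R) <= b%:R by apply/ltW/ln_sublinear; rewrite ltr0n.
have lnk : ln ((2 * k ^ 2 + 3)%N%:R : R) <= (6 * k)%N%:R.
  apply: (@le_trans _ _ (ln (((2 * k + 1) ^ 2)%N%:R : R))).
    by rewrite ler_ln ?posrE ?ltr0n ?ler_nat //; nia.
  have lnk1 : ln ((2 * k + 1)%N%:R : R) <= (2 * k + 1)%N%:R.
    by apply/ltW/ln_sublinear; rewrite ltr0n addn1.
  have le2 : (2 * k + 1)%N%:R <= (3 * k)%N%:R :> R by rewrite ler_nat; lia.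
  rewrite natrX lnXn ?ltr0n ?addn1 // mulr2n -(addn1 (2 * k)).
  have -> : (6 * k)%N%:R = (3 * k)%N%:R + (3 * k)%N%:R :> R.
    by rewrite -natrD; congr _%:R; lia.
  lra.
have p3 : (0 < 2 * k ^ 2 + 3)%N by rewrite addnS.
rewrite natrM lnM ?posrE ?ltr0n ?expn_gt0 ?p3 // natrX lnXn ?ltr0n //.
move: kP; rewrite ltr_pdivrMr // => kP.
rewrite natrX expr2.
have : 2 * (b%:R + (6 * k)%N%:R *+ N) <= e * (k%:R * k%:R) :> R.
  apply: (@le_trans _ _ (2 * (b + 6 * N)%N%:R * k%:R)).
    rewrite -mulrA ler_wpM2l // -mulrnA -natrD -natrM ler_nat; nia.
  rewrite mulrA ler_wpM2r // mulrC ltW //; rewrite mulrC; lra.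
move=> H; apply: le_trans H; rewrite ler_wpM2l //; apply: lerD => //.
by rewrite lerMn2r lnk orbT.
Qed.

End Telescope.

(** * Points at which the projections are constant *)

Section Stuck.
Variables (G : groupType) (W : word_length G) (S : seq G).
Hypothesis S1 : 1%g \in S.
Hypothesis SV : forall s, s \in S -> s^-1%g \in S.
Local Notation pre := (prefix_of W).
Local Notation len := (len W).
Local Notation gp := (gp W).
Local Notation ball := (ball S).
Local Notation hproj := (hproj W S).
Local Notation ell := (ell W S).
Variable J : nat.
Implicit Types (s h x P : G).

(* The possible values of |s x| - |x| at the points x where they are
   determined by the ball of radius 4 * J. *)
Definition jumps : seq int :=
  [seq (len s)%:Z - (2 * gp s^-1%g g)%N%:Z | s <- S, g <- ball (4 * J)].

Lemma size_jumps : size jumps = (size S * size S ^ (4 * J))%N.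
Proof. by rewrite size_allpairs size_ball. Qed.

Notation N := (size jumps).

Lemma jump_mem s g : s \in S -> g \in ball (4 * J) ->
  exists b : 'I_N, jumps`_b = (len s)%:Z - (2 * gp s^-1%g g)%N%:Z.
Proof.
move=> sS gB; set c := _ - _.
have cj : c \in jumps by apply/allpairsP; exists (s, g).
have cN : (index c jumps < N)%N by rewrite index_mem.
by exists (Ordinal cN); rewrite /= nth_index.
Qed.

Definition comb (n : 'I_N -> int) : int := \sum_(b < N) n b * jumps`_b.

Lemma comb_add n c b : comb (fun a => n a + (if a == b then c else 0)) =
  comb n + c * jumps`_b.
Proof.
rewrite /comb (eq_bigr _ (fun i _ => mulrDl _ _ _)) big_split /=; congr (_ + _).
rewrite (bigD1 b) //= eqxx big1 ?addr0 // => i /negPf ->.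
by rewrite mul0r.
Qed.

(** Subtracting j from an ordinal below 2 j + 1 encodes a coefficient in [-j, j]; the sign [sg]
    accounts for reflections. *)
Definition targets j (a : int) : seq int :=
  [seq sg * a + comb (fun b => (n b : nat)%:Z - j%:Z) |
    sg : int <- [:: 1; -1],
    n : {ffun 'I_N -> 'I_(2 * j).+1} <- enum {ffun 'I_N -> 'I_(2 * j).+1}].

Lemma size_targets j a : size (targets j a) = (2 * (2 * j).+1 ^ N)%N.
Proof. by rewrite size_allpairs -cardE card_ffun !card_ord. Qed.

Lemma targetsP j a v :
  (exists (sg : int) (n : 'I_N -> int), [/\ sg = 1 \/ sg = -1,
     forall b, `|n b| <= j%:Z & v = sg * a + comb n]) <-> v \in targets j a.
Proof.
split=> [[sg [n [sg1 nj ->]]]|/allpairsP[[sg n] /= [sg1 _ ->]]].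
  pose m : {ffun 'I_N -> 'I_(2 * j).+1} := [ffun b => inord (absz (n b + j%:Z))].
  apply/allpairsP; exists (sg, m); split=> /=.
  - by case: sg1 => ->; rewrite !inE ?eqxx ?orbT.
  - by rewrite mem_enum.
  - congr (_ + _); apply: eq_bigr => b _; congr (_ * _).
    rewrite ffunE; have := nj b; case: (n b) => [k|k] h;
      by rewrite inordK; lia.
exists sg, (fun b => (n b : nat)%:Z - j%:Z); split=> //.
- by move: sg1; rewrite !inE => /orP[/eqP|/eqP]; [left|right].
- by move=> b; have := ltn_ord (n b); lia.
Qed.

(** Either relation is absorbed by changing the coefficient of the jump b by 1 up to sign; the
    reflection also reverses [sg]. *)
Lemma targets_step j a a' v (b : 'I_N) :
  a = a' - jumps`_b \/ a = jumps`_b - a' ->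
  v \in targets j a -> v \in targets j.+1 a'.
Proof.
move=> aE /targetsP[sg [n [sg1 nj ->]]]; apply/targetsP.
have bnd c : `|c| <= 1 -> forall i, `|n i + (if i == b then c else 0)| <= j.+1%:Z.
  by move=> c1 i; have := nj i; case: ifP => _; lia.
case: aE => ->.
- exists sg, (fun i => n i + (if i == b then - sg else 0)); split=> //.
    by apply: bnd; case: sg1 => ->; lia.
  by rewrite comb_add; ring.
- exists (- sg), (fun i => n i + (if i == b then sg else 0)); split=> //.
  + by case: sg1 => ->; [right|left]; rewrite ?opprK.
  + by apply: bnd; case: sg1 => ->; lia.
  + by rewrite comb_add; ring.
Qed.

(** Since 1 lies in the ball, its convex hull is the union of the geodesics from 1 to its
    elements. *)
Definition in_hull x := has (fun g => x == pre g (len x)) (ball (2 * J)).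

(* The translates h of the hull that contain P, in a position that differs
   from that of 1 by at most j jumps and a reflection. *)
Definition aligned j P : seq G :=
  [seq h <- undup (ball j) | in_hull (h^-1 * P)%g &
     (len (h^-1 * P)%g)%:Z \in targets j (len P)%:Z].

Lemma aligned_uniq j P : uniq (aligned j P).
Proof. by rewrite filter_uniq // undup_uniq. Qed.

Lemma aligned_ball j P : {subset aligned j P <= ball j}.
Proof. by move=> h; rewrite mem_filter mem_undup => /andP[]. Qed.

Lemma aligned1 j P : in_hull P -> 1%g \in aligned j P.
Proof.
move=> PD; rewrite mem_filter mem_undup ball1 // invg1 mul1g PD /= andbT.
apply/targetsP; exists 1, (fun=> 0); split; [by left|by []|].
by rewrite /comb big1 ?mul1r ?addr0 // => i _; rewrite mul0r.
Qed.

Lemma size_aligned_gt0 j P : in_hull P -> (0 < size (aligned j P))%N.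
Proof. by move/(aligned1 j); case: aligned. Qed.

(** h is determined by h^-1 P, which is the prefix of an element of the fixed ball [ball (2 * J)],
    cut at a length among the targets. The bound is therefore polynomial in j, although [ball j] may
    grow exponentially. *)
Lemma size_aligned j P :
  (size (aligned j P) <= size S ^ (2 * J) * (2 * (2 * j).+1 ^ N))%N.
Proof.
rewrite -(size_targets j (len P)%:Z) -size_ball.
rewrite -(size_allpairs (fun g v => P * (pre g (absz v))^-1)%g).
apply: uniq_leq_size; first exact: aligned_uniq.
move=> h; rewrite mem_filter => /andP[/andP[/hasP[g gB /eqP e] hv] _].
apply/allpairsP; exists (g, (len (h^-1 * P)%g)%:Z); split=> //=.
by rewrite -e invgM invgK mulVKg.
Qed.

Lemma len1 : len 1%g = 0%N.
Proof.
have := gpM W 1%g 1%g; rewrite mulg1 invg1.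
have h := gp_ge (leqnn (len 1%g)) (leqnn _) erefl.
have /eqP -> : (len 1%g - gp 1%g 1%g == 0)%N by rewrite subn_eq0.
by move=> e; move: h; rewrite e leqn0 => /eqP.
Qed.

Lemma gp1 x : gp x 1%g = 0%N.
Proof. by have := gp_lenr W x 1%g; rewrite len1 leqn0 => /eqP. Qed.

(** P is a prefix of some g in the ball. If s^-1 leaves g before P, the length changes by the jump
    of (s, g). Otherwise P lies on the geodesic from 1 to s^-1 and its position is reflected to len
    s - len P, where len s is the jump of (s, 1). *)
Lemma len_jump s P : s \in S -> in_hull P -> exists b : 'I_N,
  (len P)%:Z = (len (s * P)%g)%:Z - jumps`_b \/
  (len P)%:Z = jumps`_b - (len (s * P)%g)%:Z.
Proof.
move=> sS /hasP[g gB /eqP e].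
have gL : g \in ball (4 * J) by apply: ball_mono gB => //; lia.
have := gp_pre W s^-1%g g (len P); rewrite -e [gp P _]gpC => cE.
have cs := gp_len W s^-1%g P; have cP := gp_lenr W s^-1%g P.
rewrite lenV in cs; rewrite lenM.
have [le|lt] := leqP (len P) (gp g s^-1%g).
  have [b bE] := jump_mem sS (ball1 S1 (4 * J)).
  exists b; right; rewrite bE gp1; move: cE; rewrite (minn_idPl le); lia.
have [b bE] := jump_mem sS gL; exists b; left; rewrite bE [gp _ g]gpC.
by move: cE; rewrite (minn_idPr (ltnW lt)); lia.
Qed.

(** (s h)^-1 (s P) = h^-1 P, so only the reference length changes, from that of P to that of s P. *)
Lemma aligned_mul s j P h : s \in S -> in_hull P ->
  h \in aligned j P -> (s * h)%g \in aligned j.+1 (s * P)%g.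
Proof.
move=> sS PD; rewrite !mem_filter !mem_undup invgM -mulgA mulKg.
move=> /andP[/andP[-> hv] hB]; rewrite ball_mul // andbT /=.
have [b bE] := len_jump sS PD; exact: targets_step bE hv.
Qed.

Lemma aligned_mono j P : in_hull P -> {subset aligned j P <= aligned j.+1 P}.
Proof. by move=> PD h /(aligned_mul S1 PD); rewrite !mul1g. Qed.

Lemma hproj_hull x : in_hull (hproj (2 * J) x).
Proof.
have [g gB e] := ell_ex W S1 (2 * J) x.
apply/hasP; exists g => //; rewrite /hproj len_pre (minn_idPl _); last first.
  exact: ell_len.
by apply/eqP; rewrite (@pre_gp _ _ g x) // e.
Qed.

Variable R : realType.

(** The translate by s of the set of index j + 1 at P and the set of index j + 1 at s P both lie
    between the sets of indices j and j + 2 at s P. *)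
Lemma aligned_avg s j x phi : s \in S ->
  let P := hproj (2 * J) x in
  hproj (2 * J) (s * x)%g = (s * P)%g -> (forall t, `|phi t| <= 1 :> R) ->
  avg (aligned j.+1 (s * P)%g) phi - avg (aligned j.+1 P) (fun t => phi (s * t)%g) <=
  2 * (1 - (size (aligned j (s * P)%g))%:R / (size (aligned j.+2 (s * P)%g))%:R).
Proof.
move=> sS P e phi1.
have PD : in_hull P by exact: hproj_hull.
have sPD : in_hull (s * P)%g by rewrite -e; exact: hproj_hull.
have -> : avg (aligned j.+1 P) (fun t => phi (s * t)%g) =
    avg [seq (s * h)%g | h <- aligned j.+1 P] phi.
  by rewrite avg_map.
apply: avg_sandwich => //; try exact: aligned_uniq.
- by rewrite map_inj_uniq ?aligned_uniq //; exact: mulgI.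
- exact: size_aligned_gt0.
- exact: aligned_mono.
- move=> h hA; apply/mapP; exists (s^-1 * h)%g; last by rewrite mulVKg.
  by have := aligned_mul (SV sS) sPD hA; rewrite mulKg.
- exact: aligned_mono.
- by move=> _ /mapP[h hA ->]; exact: aligned_mul.
Qed.

End Stuck.

(** * Rounding down in a finite set of integers *)

Section Floor.
Implicit Types (D : seq int) (y d : int).

(* 0 if no element of D is below y. *)
Definition floor_in D y : int :=
  let l := [seq d <- D | d <= y] in foldr Num.max (head 0 l) l.

Definition rank D y := count (<= y) D.

Lemma foldr_max_ge (a : int) l d : d \in l -> d <= foldr Num.max a l.
Proof.
elim: l => //= b l IH; rewrite inE le_max => /predU1P[->|/IH ->].
  by rewrite lexx.
by rewrite orbT.
Qed.

Lemma foldr_max_mem (a : int) l : foldr Num.max a l \in a :: l.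
Proof.
elim: l => /= [|b l IH]; first by rewrite mem_seq1.
by rewrite maxEle; case: ifP => _; move: IH; rewrite !inE ?eqxx ?orbT //;
  case/orP => ->; rewrite ?orbT.
Qed.

Lemma floor_ge D y d : d \in D -> d <= y -> d <= floor_in D y.
Proof. by move=> dD dy; apply: foldr_max_ge; rewrite mem_filter dD dy. Qed.

Lemma floor_mem D y d : d \in D -> d <= y ->
  floor_in D y \in D /\ floor_in D y <= y.
Proof.
move=> dD dy; have : floor_in D y \in [seq d <- D | d <= y]; last first.
  by rewrite mem_filter => /andP[].
rewrite /floor_in; have : d \in [seq d <- D | d <= y] by rewrite mem_filter dD dy.
case: [seq d <- D | d <= y] => [//|a l] _.
by have := foldr_max_mem a (a :: l); rewrite !inE orbA orbb.
Qed.

Lemma rank_mono D y y' : y <= y' -> (rank D y <= rank D y')%N.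
Proof. by move=> yy'; apply: sub_count => d /= /le_trans; apply. Qed.

(** The sublists below y and y' are nested, so equal counts make them equal. *)
Lemma floor_rank D y y' : rank D y = rank D y' -> floor_in D y = floor_in D y'.
Proof.
wlog yy' : y y' / y <= y'.
  move=> H e; case: (leP y y') => [|/ltW] h; first exact: H.
  by apply/esym/H.
move=> e; rewrite /floor_in.
have -> // : [seq d <- D | d <= y] = [seq d <- D | d <= y'].
move: e; rewrite /rank; elim: D => //= d D IH.
have cD : (count (<= y) D <= count (<= y') D)%N by exact: rank_mono.
case: (leP d y) => [dy|dy].
  by rewrite (le_trans dy yy') => -[/IH ->].
case: (leP d y') => // _; rewrite add0n add1n => e.
by rewrite e ltnn in cD.
Qed.

Lemma rank_size D y : (rank D y <= size D)%N.
Proof. exact: count_size. Qed.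

Lemma sum_jumps (f : nat -> nat) (b n : nat) :
  (forall r, f r <= f r.+1)%N -> (forall r, f r <= b)%N ->
  (\sum_(r < n) (f r != f r.+2) <= 2 * b)%N.
Proof.
move=> fS fb; apply: (@leq_trans (f n + f n.+1)); last first.
  by have := fb n; have := fb n.+1; lia.
elim: n => [|n IH]; first by rewrite big_ord0.
rewrite big_ord_recr /=; have := fS n; have := fS n.+1; move: IH.
by case: eqP => h /=; lia.
Qed.

End Floor.

Lemma card_ffun_eq (I T : finType) (a : I) (t : T) :
  (#|[pred n : {ffun I -> T} | n a == t]| * #|T| = #|T| ^ #|I|)%N.
Proof.
have -> : #|[pred n : {ffun I -> T} | n a == t]| =
    #|(family (fun b => if b == a then pred1 t else predT) :
        simpl_pred {ffun I -> T})|.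
  apply: eq_card => n; rewrite !inE; apply/idP/familyP => [/eqP na b|/(_ a)].
    by case: eqP => // ->; rewrite inE na.
  by rewrite eqxx inE.
have -> : (#|T| ^ #|I| = \prod_(b : I) #|T|)%N by rewrite prod_nat_const.
rewrite card_family foldrE big_map big_enum /= (bigD1 a) //= [RHS](bigD1 a) //=.
rewrite eqxx card1 mul1n mulnC; congr (_ * _)%N.
by apply: eq_bigr => b /negPf ->.
Qed.

(** * Points at which the projections move *)

Section Pinned.
Variables (G : groupType) (W : word_length G) (S : seq G).
Hypothesis S1 : 1%g \in S.
Hypothesis SV : forall s, s \in S -> s^-1%g \in S.
Local Notation pre := (prefix_of W).
Local Notation len := (len W).
Local Notation gp := (gp W).
Local Notation ball := (ball S).
Local Notation hproj := (hproj W S).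
Local Notation ell := (ell W S).
Variable J : nat.
Local Notation jumps := (jumps W S J).
Local Notation N := (size jumps).
Variables M K : nat.
Implicit Types (s h x P : G).

Local Notation grid := {ffun 'I_N -> 'I_M.+1}.

Definition offset (n : grid) : int := \sum_(b < N) (n b : nat)%:Z * jumps`_b.

Definition levels : seq int :=
  [seq (p.1 : int) - p.2 |
    p <- [seq (q, e) | q <- [seq (gp g h)%:Z | g <- ball (4 * J), h <- ball (4 * J)],
                       e <- [seq offset n | n <- enum {ffun 'I_N -> 'I_M.+1}]]].

Lemma size_levels :
  size levels = (size S ^ (4 * J) * size S ^ (4 * J) * M.+1 ^ N)%N.
Proof.
by rewrite size_map !size_allpairs !size_ball size_map -cardE card_ffun !card_ord.
Qed.

Lemma level_mem g h n : g \in ball (4 * J) -> h \in ball (4 * J) ->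
  (gp g h)%:Z - offset n \in levels.
Proof.
move=> gB hB; apply/mapP; exists ((gp g h)%:Z, offset n) => //.
apply/allpairsP; exists ((gp g h)%:Z, offset n); split=> //=.
  by apply/allpairsP; exists (g, h).
by apply: map_f; rewrite mem_enum.
Qed.

(* When x moves to s x and n by one step in the direction of the jump of s at x,
   ell r x - offset n is unchanged up to replacing r by r - 1 or r + 1. Rounding
   it down in the fixed finite set levels makes the position equivariant for
   most r, and levels is rich enough for the position to be past the point where the
   geodesics from s^-1 and from 1 to x merge. *)
Definition pos x (n : grid) (r : nat) : int :=
  offset n + floor_in levels ((ell r x)%:Z - offset n).

(** Radii start at 2 so that the radius one smaller, used in the comparison with s x, is still
    positive. *)
Definition marker x (i : grid * 'I_K) : G := pre x (absz (pos x i.1 i.2.+2)).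

Definition markers x := [seq marker x i | i <- enum {: grid * 'I_K}].

Lemma size_markers x : size (markers x) = (M.+1 ^ N * K)%N.
Proof. by rewrite size_map -cardE card_prod card_ffun !card_ord. Qed.

Lemma pos_bound x n r (c : nat) : (c <= ell r x)%N ->
  c%:Z - offset n \in levels ->
  [/\ c%:Z <= pos x n r, pos x n r <= (ell r x)%:Z &
      exists2 d, d \in levels & pos x n r = offset n + d].
Proof.
move=> ce cl.
have ce' : c%:Z - offset n <= (ell r x)%:Z - offset n by lia.
have [fl fe] := floor_mem cl ce'; have fg := floor_ge cl ce'.
by rewrite /pos; split; [lia|lia|exists (floor_in levels ((ell r x)%:Z - offset n))].
Qed.

Definition anchors : seq G :=
  [seq pre p.1 (absz p.2) | p <- [seq (h, p) | h <- ball K.+1,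
     p <- [seq e + d | e <- [seq offset n | n <- enum {ffun 'I_N -> 'I_M.+1}],
                       d <- levels]]].

Lemma size_anchors :
  size anchors = (size S ^ K.+1 * (M.+1 ^ N * size levels))%N.
Proof.
rewrite expnS size_map !size_allpairs size_ball size_map -cardE card_ffun.
by rewrite !card_ord.
Qed.

(** [levels] contains the level of position 0, so the position is nonnegative; it is at most [ell],
    so the marker is also a prefix of the element of the ball that attains [ell]. *)
Lemma markers_anchors x : {subset markers x <= anchors}.
Proof.
move=> _ /mapP[[n r] _ ->]; rewrite /marker /=.
have l0 : 0%:Z - offset n \in levels.
  by rewrite -(gp1 W 1%g) level_mem // ball1.
have [p0 pe [d dl pE]] := pos_bound (leq0n (ell r.+2 x)) l0.
have [h hB eE] := ell_ex W S1 r.+2 x.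
apply/mapP; exists (h, pos x n r.+2); last first.
  by apply/esym/pre_gp; rewrite -eE /=; lia.
apply/allpairsP; exists (h, pos x n r.+2); split => //=.
  exact: (@ball_mono _ S S1 r.+2 K.+1 (ltn_ord r) h hB).
rewrite pE; apply/allpairsP; exists (offset n, d); split=> //=.
by apply: map_f; rewrite mem_enum.
Qed.

(** The step in direction a is cyclic in order to be a bijection of the grid; the points where it
    wraps around are counted as bad. *)
Definition turn (a : 'I_N) (n : grid) : grid :=
  [ffun b => if b == a then ordS (n b) else n b].

Lemma turn_bij a : bijective (turn a).
Proof.
exists (fun n : grid => [ffun b => if b == a then ord_pred (n b) else n b]);
  move=> n; apply/ffunP => b; rewrite !ffunE; case: eqP => // _.
- by rewrite ordSK.
- by rewrite ord_predK.
Qed.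

Lemma offset_turn a (n : grid) :
  n a != ord_max -> offset (turn a n) = offset n + jumps`_a.
Proof.
move=> na; rewrite /offset (bigD1 a) //= [in RHS](bigD1 a) //= ffunE eqxx.
have -> : (ordS (n a) : nat) = (n a).+1.
  rewrite /= modn_small // ltn_neqAle ltn_ord andbT.
  by apply: contra na => /eqP[e]; apply/eqP/val_inj.
rewrite (eq_bigr (fun b => (n b : nat)%:Z * jumps`_b)) => [|b /negPf ba].
  by rewrite -addn1 PoszD mulrDl mul1r addrAC.
by rewrite ffunE ba.
Qed.

Definition bad x (a : 'I_N) (i : grid * 'I_K) : bool :=
  (i.1 a == ord_max) ||
  (rank levels ((ell i.2.+1 x)%:Z - offset i.1) !=
   rank levels ((ell i.2.+3 x)%:Z - offset i.1)).

Lemma good_marker s x g (a : 'I_N) (i : grid * 'I_K) :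
  s \in S -> g \in ball (4 * J) -> (0 < J)%N -> gp s^-1%g x = gp s^-1%g g ->
  jumps`_a = (len s)%:Z - (2 * gp s^-1%g g)%N%:Z ->
  ~~ bad x a i -> marker (s * x)%g (turn a i.1, i.2) = (s * marker x i)%g.
Proof.
case: i => n r; rewrite /bad negb_or negbK /= => sS gB J0 cg aE /andP[na /eqP rk].
have sB : s^-1%g \in ball (4 * J) by apply: mem_ball; rewrite ?SV //; lia.
set c := gp s^-1%g x in cg.
(* This level makes the position at x at least c, as [mul_pre] requires. *)
have cl : c%:Z - offset n \in levels by rewrite cg level_mem.
have ce k : (c <= ell k.+1 x)%N by exact: gp_ell.
have cs : (c <= len s)%N by have := gp_len W s^-1%g x; rewrite lenV.
have [pc pe _] := pos_bound (ce r.+1) cl.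
rewrite /marker /= mul_pre -/c; last by lia.
congr (pre _ _).
(* [ell_shift] and [ell_shiftV] place the left argument between those of x at radii r + 1 and r + 3,
   where the rank is the same. *)
have floorE : floor_in levels ((ell r.+2 (s * x)%g)%:Z - offset (turn a n)) =
    floor_in levels ((ell r.+2 x)%:Z - offset n).
  have bnd y : (ell r.+1 x)%:Z - offset n <= y ->
      y <= (ell r.+3 x)%:Z - offset n ->
      rank levels y = rank levels ((ell r.+1 x)%:Z - offset n).
    move=> /(rank_mono levels) h1 /(rank_mono levels) h2.
    by move: h1 h2; rewrite -rk; lia.
  apply: floor_rank; rewrite !bnd //.
  - by have := ell_mono W S1 x (leqnSn r.+1); lia.
  - by have := ell_mono W S1 x (leqnSn r.+2); lia.
  - rewrite offset_turn // aE -cg.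
    by have := ell_shift W S1 SV x sS (ltn0Sn r); rewrite -/c; have := ce r; lia.
  - rewrite offset_turn // aE -cg.
    have := ell_shiftV W S1 SV x sS (ltn0Sn r.+1); rewrite -/c.
    by have := ce r.+2; lia.
have -> : pos (s * x)%g (turn a n) r.+2 = pos x n r.+2 + jumps`_a.
  by rewrite /pos floorE offset_turn //; ring.
rewrite aE -cg; lia.
Qed.

Variable R : realType.

(** Wrapping around affects a proportion 1 / (M + 1) of the grid. For each grid point the rank is
    monotone in the radius and bounded by [size levels], so it changes at most twice that often. *)
Lemma sum_bad x a :
  \sum_i (bad x a i)%:R <=
  (M.+1 ^ N * K)%N%:R / M.+1%:R + (M.+1 ^ N * (2 * size levels))%N%:R :> R.
Proof.
apply: (@le_trans _ _ (\sum_(n : grid) \sum_(r < K) ((n a == ord_max)%:R +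
    (rank levels ((ell r.+1 x)%:Z - offset n) !=
     rank levels ((ell r.+3 x)%:Z - offset n))%:R))).
  rewrite pair_bigA /=; apply: ler_sum => -[n r] _; rewrite /bad /=.
  by case: (_ == _); case: (_ != _) => /=; rewrite ?addr0 ?add0r ?lerDl.
under eq_bigr do rewrite big_split; rewrite big_split /=.
apply: lerD.
  rewrite (eq_bigr (fun n : grid => (n a == ord_max)%:R * K%:R)); last first.
    by move=> n _; rewrite sumr_const card_ord mulr_natr.
  rewrite -mulr_suml natrM mulrAC ler_wpM2r //.
  rewrite ler_pdivlMr ?ltr0n // -natr_sum -natrM ler_nat.
  rewrite -[X in (_ <= X ^ _)%N](card_ord M.+1) -[X in (_ <= _ ^ X)%N](card_ord N).
  rewrite -(card_ffun_eq a (ord_max : 'I_M.+1)) card_ord leq_mul2r /=.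
  by rewrite -sum1_card [leqRHS]big_mkcond.
rewrite natrM -[(M.+1 ^ N)%N%:R]mulr1 -mulrA.
have -> : (M.+1 ^ N)%N = #|{: grid}| by rewrite card_ffun !card_ord.
rewrite mulr_natl -sumr_const; apply: ler_sum => n _.
rewrite -natr_sum mul1r ler_nat.
apply: (@sum_jumps (fun r => rank levels ((ell r.+1 x)%:Z - offset n))) => r.
  by apply: rank_mono; have := ell_mono W S1 x (leqnSn r.+1); lia.
exact: rank_size.
Qed.

End Pinned.

(** * The uniform property A *)

Section Mixture.
Variables (G : groupType) (W : word_length G) (S : seq G).
Hypothesis S1 : 1%g \in S.
Hypothesis SV : forall s, s \in S -> s^-1%g \in S.
Variable R : realType.
Variables J M K n : nat.
Hypotheses (J0 : (0 < J)%N) (K0 : (0 < K)%N) (n0 : (0 < n)%N).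
Local Notation N := (size S * size S ^ (4 * J))%N.
Local Notation stuck := (stuck W S J).
Implicit Types (s x : G) (phi : G -> R).

(** If exactly one of x and s x is stuck at some threshold, both are stuck at every later one in the
    range. *)
Lemma stuck_change s x : s \in S ->
  (\sum_(i < J) (stuck i.+1 x != stuck i.+1 (s * x)%g) <= 1)%N.
Proof.
(* The induction needs the sharper bound: a change can have occurred only if both points are now
   stuck. *)
move=> sS; suff H m : (m <= J)%N ->
    (\sum_(i < m) (stuck i.+1 x != stuck i.+1 (s * x)%g) <=
       (stuck m.+1 x && stuck m.+1 (s * x)%g))%N.
  by apply: leq_trans (H J (leqnn _)) _; apply: leq_b1.
elim: m => [|m IH] mJ; first by rewrite big_ord0.
have i2 : (m.+1 < 2 * J)%N by lia.
rewrite big_ord_recr /=; have := IH (ltnW mJ).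
have := @stuck_mono _ W _ S1 _ _ x i2.
have := @stuck_mono _ W _ S1 _ _ (s * x)%g i2.
have := @stuck_shift _ W _ S1 SV s _ _ x sS (ltn0Sn m) i2.
have := @stuck_shiftV _ W _ S1 SV s _ _ x sS (ltn0Sn m) i2.
case: (stuck m.+1 x); case: (stuck m.+1 (s * x)%g) => /=.
- by move=> _ _ -> // -> //; rewrite addn0.
- by move=> _ -> // _ -> //=; lia.
- by move=> -> // _ -> // _ /=; lia.
- by lia.
Qed.

(** Thresholds start at 1 because the shift lemmas need a positive radius; the index j + 1 leaves
    room for j and j + 2 in [aligned_avg]. *)
Definition sample x (i : 'I_J) (j : 'I_n) : seq G :=
  if stuck i.+1 x then aligned W S J j.+1 (hproj W S (2 * J) x)
  else markers W S J M K x.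

Definition atoms : seq G := undup (ball S n ++ anchors W S J M K).

Lemma sample_atoms x i j : {subset sample x i j <= atoms}.
Proof.
move=> h; rewrite /sample mem_undup mem_cat; case: ifP => _.
  by move/aligned_ball => /(@ball_mono _ _ S1 j.+1 n (ltn_ord j)) ->.
by move/markers_anchors => ->; rewrite ?orbT.
Qed.

Lemma sample_gt0 x i j : (0 < size (sample x i j))%N.
Proof.
rewrite /sample; case: ifP => _.
  by apply: size_aligned_gt0 => //; exact: hproj_hull.
by rewrite size_markers muln_gt0 K0 expn_gt0.
Qed.

Definition weight x t : R :=
  (\sum_(i < J) \sum_(j < n) mass R (sample x i j) t) / (J * n)%N%:R.

Lemma weight_ge0 x t : 0 <= weight x t.
Proof.
rewrite divr_ge0 // sumr_ge0 // => i _; apply: sumr_ge0 => j _.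
exact: mass_ge0.
Qed.

Lemma weight_avg x phi : \sum_(t <- atoms) weight x t * phi t =
  (\sum_(i < J) \sum_(j < n) avg (sample x i j) phi) / (J * n)%N%:R.
Proof.
rewrite /weight.
rewrite (eq_bigr (fun t => (\sum_(i < J) \sum_(j < n)
   mass R (sample x i j) t * phi t) / (J * n)%N%:R)); last first.
  move=> t _; rewrite mulrAC mulr_suml; congr (_ / _).
  by apply: eq_bigr => i _; rewrite mulr_suml.
rewrite -mulr_suml exchange_big /=; congr (_ / _); apply: eq_bigr => i _.
rewrite exchange_big /=; apply: eq_bigr => j _.
by rewrite sum_mass ?undup_uniq //; exact: sample_atoms.
Qed.

Lemma sum_weight x : \sum_(t <- atoms) weight x t = 1.
Proof.
have := weight_avg x (fun=> 1); rewrite (eq_bigr _ (fun t _ => mulr1 _)) => ->.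
rewrite (eq_bigr (fun=> n%:R)) => [|i _].
  by rewrite sumr_const card_ord -mulrnA mulnC divff // pnatr_eq0; lia.
rewrite (eq_bigr (fun=> 1)) => [|j _]; first by rewrite sumr_const card_ord.
by rewrite avg_const // sample_gt0.
Qed.

(** At most one of the J thresholds separates x from s x, which costs 2 / J. At each other threshold
    the error is at most e, by the telescoping ratios in the stuck case and by counting bad indices
    in the other. *)
Lemma weight_almost_invariant (e : R) s x phi :
  2 / M.+1%:R + 4 * (size S ^ (4 * J) * size S ^ (4 * J) * M.+1 ^ N)%N%:R / K%:R
    <= e ->
  2 * ln (size S ^ (2 * J) * 2 * (2 * n + 3) ^ N)%N%:R <= e / 2 * n%:R ->
  s \in S -> (forall t, `|phi t| <= 1) ->
  \sum_(t <- atoms) weight (s * x)%g t * phi t -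
  \sum_(t <- atoms) weight x t * phi (s * t)%g <= e + 2 / J%:R.
Proof.
move=> eK en sS phi1.
rewrite (weight_avg x (fun t => phi (s * t)%g)) weight_avg -mulrBl.
rewrite ler_pdivrMr ?ltr0n ?muln_gt0 ?J0 // -sumrB.
rewrite (eq_bigr _ (fun i _ => esym (sumrB _ _ _ _))).
pose d (i : 'I_J) := stuck i.+1 x != stuck i.+1 (s * x)%g.
have main i : \sum_(j < n) (avg (sample (s * x)%g i j) phi -
    avg (sample x i j) (fun t => phi (s * t)%g)) <=
    e * n%:R + 2 * n%:R * (d i)%:R.
  have e0 : 0 <= e by apply: le_trans eK; rewrite addr_ge0 ?divr_ge0 ?mulr_ge0.
  have [di|] := boolP (d i).
    apply: (@le_trans _ _ (\sum_(j < n) 2)).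
      by apply: ler_sum => j _; apply: avg_le2 => //; exact: sample_gt0.
    by rewrite sumr_const card_ord -[leLHS]mulr_natr mulr1 lerDr mulr_ge0.
  rewrite mulr0 addr0 /d negbK => /eqP st.
  have i2 : (i.+1 < 2 * J)%N by have := ltn_ord i; lia.
  rewrite /sample -st; have [stx|stx] := boolP (stuck i.+1 x).
    have pE := stuck_hproj S1 SV sS (ltn0Sn i) i2 stx.
    rewrite pE; set P := hproj _ _ _ _.
    have sPD : in_hull W S J (s * P)%g by rewrite -pE; exact: hproj_hull.
    pose a j := size (aligned W S J j (s * P)%g).
    apply: (@le_trans _ _ (\sum_(j < n) 2 * (1 - (a j)%:R / (a j.+2)%:R))).
      by apply: ler_sum => j _; exact: aligned_avg.
    rewrite -mulr_sumr -(big_mkord xpredT (fun j => 1 - (a j)%:R / (a j.+2)%:R)).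
    rewrite (_ : e * n%:R = 2 * (e / 2 * n%:R)); last by field.
    rewrite ler_wpM2l //; apply: le_trans en; apply: sum_ratio => j jn.
    rewrite size_aligned_gt0 //=; apply: leq_trans (size_aligned W S J _ _) _.
    rewrite size_jumps mulnA leq_mul2l; apply/orP; right.
    have Sgt0 : (0 < size S)%N by case: (S) S1.
    rewrite leq_exp2r ?muln_gt0 ?expn_gt0 ?Sgt0 //; lia.
  rewrite /= sumr_const card_ord -[leLHS]mulr_natr ler_wpM2r //; apply: le_trans eK.
  have [g gB gE] := not_stuck S1 SV sS (ltn0Sn i) stx i2.
  have [a aE] := jump_mem W sS gB.
  have gd := good_marker S1 SV sS gB J0 gE aE.
  pose tau (o : {ffun 'I_(size (jumps W S J)) -> 'I_M.+1} * 'I_K) :=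
    (turn a o.1, o.2).
  have btau : bijective tau.
    have [f fK Kf] := turn_bij M a.
    by exists (fun o => (f o.1, o.2)) => -[o r]; rewrite /tau /= ?fK ?Kf.
  have good o : ~~ bad x a o -> phi (marker (s * x)%g (tau o)) =
      phi (s * marker x o)%g by move=> /gd <-.
  apply: (le_trans (avg_image btau good phi1 (fun t => phi1 _))).
  have sb := sum_bad S1 M K R x a.
  rewrite card_prod card_ffun !card_ord; move: sb; set sumb := \sum_i _.
  rewrite size_levels size_jumps; clearbody sumb => sb.
  set Q := (M.+1 ^ _)%N in sb *; set Lv := (_ * _ * Q)%N in sb *.
  have Q0 : 0 < Q%:R :> R by rewrite ltr0n expn_gt0.
  have K0' : 0 < K%:R :> R by rewrite ltr0n.
  rewrite ler_pdivrMr ?natrM ?mulr_gt0 //.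
  have M0 : 0 < M.+1%:R :> R by rewrite ltr0n.
  apply: (@le_trans _ _ (2 * ((Q * K)%N%:R / M.+1%:R + (Q * (2 * Lv))%N%:R))).
    by rewrite ler_wpM2l.
  rewrite !natrM le_eqVlt; apply/orP; left; apply/eqP; field.
  by rewrite gt_eqF //= -natr1 addrC in M0 *; rewrite gt_eqF.
apply: (le_trans (ler_sum _ (fun i _ => main i))).
rewrite big_split /= sumr_const card_ord -mulr_sumr -natr_sum [leRHS]mulrDl.
apply: lerD; first by rewrite natrM -[leLHS]mulr_natr -mulrA [n%:R * _]mulrC.
have dc : (\sum_i d i)%:R <= 1 :> R by rewrite (ler_nat R _ 1); exact: stuck_change.
have -> : 2 / J%:R * (J * n)%N%:R = 2 * n%:R * 1 :> R.
  by rewrite natrM; field; rewrite pnatr_eq0 -lt0n.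
by rewrite ler_wpM2l ?mulr_ge0.
Qed.

End Mixture.

Lemma inv_small (R : realType) (c e : R) : 0 <= c -> 0 < e ->
  exists n : nat, c / n.+1%:R <= e.
Proof.
move=> c0 e0; exists (Num.bound (c / e)).
have := archi_boundP (divr_ge0 c0 (ltW e0)).
rewrite ltr_pdivrMr // => h; rewrite ler_pdivrMr ?ltr0n // -natr1 mulrDr mulr1.
by rewrite mulrC; apply: (le_trans (ltW h)); rewrite lerDl ltW.
Qed.

(** Padding with weight 0 allows the same number of points for all groups and all sets S. *)
Lemma sum_pad (R : realType) (T : eqType) (x0 : T) (l : seq T) (n : nat)
    (f : T -> R) : (size l <= n)%N ->
  \sum_(i < n) (if (i < size l)%N then f (nth x0 l i) else 0) = \sum_(t <- l) f t.
Proof.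
move=> ln; rewrite (big_nth x0) big_mkord.
rewrite (big_ord_widen n (fun i => f (nth x0 l i)) ln).
by rewrite -big_mkcond.
Qed.

(** The l1 estimate is stated in dual form, against test functions bounded by 1: this allows
    repeated points and is linear in the weights, so it can be carried through characters. *)
Theorem uniform_property_A (R : realType) (k : nat) (e : R) : 0 < e ->
  exists N : nat, forall (G : groupType) (W : word_length G) (S : seq G),
    size S = k -> exists (F : 'I_N -> G) (wt : G -> 'I_N -> R),
    [/\ forall x i, 0 <= wt x i, forall x, \sum_i wt x i = 1 &
        forall s x (phi : G -> R), s \in S -> (forall t, `|phi t| <= 1) ->
          \sum_i wt (s * x)%g i * phi (F i) -
          \sum_i wt x i * phi (s * F i)%g <= e].
Proof.
move=> e0; have e4 : 0 < e / 4 by rewrite divr_gt0.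
have e2 : 0 < e / 2 by rewrite divr_gt0.
(* The length of the given list after adjoining 1 and all inverses, as the lemmas on balls
   require. *)
pose q := (k + k).+1.
(* Separating thresholds may cost e / 2; in the moving case, wrapping around and rank changes may
   cost e / 4 each. K is chosen after M because the number [Lv] of levels depends on J and M. *)
have [J1 JP] := inv_small (ler0n R 2) e2; pose J := J1.+1.
have [M MP] := inv_small (ler0n R 2) e4.
pose N := (q * q ^ (4 * J))%N.
pose Lv := (q ^ (4 * J) * q ^ (4 * J) * M.+1 ^ N)%N.
have [K1 KP] := inv_small (ler0n R (4 * Lv)%N) e4; pose K := K1.+1.
have [n n0 nP] := ln_poly_small (q ^ (2 * J) * 2) N e4.
exists (q ^ n + q ^ K.+1 * (M.+1 ^ N * Lv))%N => G W S0 sk.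
pose S := 1%g :: S0 ++ [seq s^-1%g | s <- S0].
have sS : size S = q by rewrite /= size_cat size_map sk.
have S1 : 1%g \in S by rewrite inE eqxx.
have SV s : s \in S -> s^-1%g \in S.
  rewrite !inE !mem_cat => /or3P[/eqP->|sS0|/mapP[t tS ->]].
  - by rewrite invg1 eqxx.
  - by rewrite (map_f _ sS0) !orbT.
  - by rewrite invgK tS orbT.
pose l := atoms W S J M K n.
have sl : (size l <= q ^ n + q ^ K.+1 * (M.+1 ^ N * Lv))%N.
  rewrite /l /atoms (leq_trans (size_undup _)) // size_cat size_ball sS.
  by rewrite size_anchors size_levels size_jumps sS.
pose m x t := weight W S R J M K n x t.
exists (fun i => nth 1%g l i),
  (fun x i => if (i < size l)%N then m x (nth 1%g l i) else 0); split.
- by move=> x i; case: ifP => // _; exact: weight_ge0.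
- by move=> x; rewrite (sum_pad _ (m x)) // sum_weight.
- move=> s x phi sS0 phi1.
  have padE (f g : G -> R) : \sum_(i < q ^ n + q ^ K.+1 * (M.+1 ^ N * Lv))
      (if (i < size l)%N then f (nth 1%g l i) else 0) * g (nth 1%g l i) =
      \sum_(t <- l) f t * g t.
    rewrite -(sum_pad 1%g _ sl); apply: eq_bigr => i _.
    by case: ifP; rewrite ?mul0r.
  rewrite (padE (m (s * x)%g) phi) (padE (m x) (fun t => phi (s * t)%g)).
  have sSS : s \in S by rewrite inE mem_cat sS0 orbT.
  apply: (le_trans (@weight_almost_invariant _ W S S1 SV R J M K n _ _ _
     (e / 2) s x phi _ _ sSS phi1)) => //; rewrite ?sS.
  + have KP' : 4 * Lv%:R / K%:R <= e / 4 by move: KP; rewrite natrM.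
    by apply: le_trans (lerD MP KP') _; lra.
  + by move: nP; rewrite -/N; lra.
  + by move: JP; rewrite -/J; lra.
Qed.

Import ComplexField.Normc.

Local Open Scope classical_set_scope.
Local Open Scope complex_scope.

(** * Real-valued families and characters of the ultrapower *)

Lemma linf_addE (R : realType) (T : pointedType) (A : normedComAlgType R)
  (f g : linf T A) x : (f + g) x = f x + g x.
Proof. by []. Qed.

Lemma linf_mulE (R : realType) (T : pointedType) (A : normedComAlgType R)
  (f g : linf T A) x : (f * g) x = f x * g x.
Proof. by []. Qed.

Section Characters.
Variables (R : realType) (U : free_ultrafilter) (G : groupType).
Local Notation A := (ultrapower U (linf_group R G)).
Local Notation GU := (gultrapower U G).
Implicit Types (f g : nat -> G -> R) (chi : spectrum A).

Definition bdd f := exists B, forall n x, `|f n x| <= B.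

Lemma normc_real (r : R) : normc r%:C = `|r|.
Proof. by rewrite /= expr0n /= addr0 sqrtr_sqr. Qed.

Lemma bdd_inner f n : bdd f -> is_bounded (fun x : carrier G => (f n x)%:C : R[i]^o).
Proof.
by move=> [B fB]; exists B => x; rewrite [anorm _]normc_real.
Qed.

Lemma bdd_outer f (fb : bdd f) :
  is_bounded (fun n => mklinf (bdd_inner n fb) : linf_group R G).
Proof.
have [B fB] := fb; exists B => n; apply: linf_norm_le => x.
by rewrite [anorm _]normc_real.
Qed.

(* Junk value 0 if f is not bounded. *)
Definition cls f : A :=
  if pselect (bdd f) is left fb then aclass U (mklinf (bdd_outer fb)) else 0.

Lemma cls_spec f : bdd f -> exists2 a : linf nat (linf_group R G),
  cls f = aclass U a & forall n x, (a n : linf_group R G) x = (f n x)%:C.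
Proof.
move=> fb; rewrite /cls; case: pselect => // fb'.
by exists (mklinf (bdd_outer fb')).
Qed.

Lemma aclass_near (a b : linf nat (linf_group R G)) :
  fu_sets U [set n | a n = b n] -> aclass U a = aclass U b.
Proof.
move=> ab; apply/aclassP/null_idealP => e e0; apply: filterS ab => n /= abn.
rewrite [X in anorm X](_ : _ = a n - b n) // abn subrr.
by rewrite anorm0.
Qed.

Lemma cls_near f (a : linf nat (linf_group R G)) : bdd f ->
  fu_sets U [set n | forall x, (a n : linf_group R G) x = (f n x)%:C] ->
  aclass U a = cls f.
Proof.
move=> /cls_spec[b -> bE] af; apply: aclass_near; apply: filterS af => n /= an.
by apply: linf_eqP => x; rewrite an bE.
Qed.

Lemma cls_eq f g : bdd f -> bdd g ->
  fu_sets U [set n | forall x, f n x = g n x] -> cls f = cls g.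
Proof.
move=> fb gb fg; have [a -> aE] := cls_spec fb; apply: cls_near => //.
by apply: filterS fg => n /= fgn x; rewrite aE fgn.
Qed.

Lemma bddD f g : bdd f -> bdd g -> bdd (fun n x => f n x + g n x).
Proof.
move=> [B fB] [C gC]; exists (B + C) => n x.
by rewrite (le_trans (ler_normD _ _)) // lerD.
Qed.

Lemma bddM f g : bdd f -> bdd g -> bdd (fun n x => f n x * g n x).
Proof.
by move=> [B fB] [C gC]; exists (B * C) => n x; rewrite normrM ler_pM.
Qed.

Lemma bdd_cst (c : R) : bdd (fun _ _ => c).
Proof. by exists `|c|. Qed.

Lemma bddZ c f : bdd f -> bdd (fun n x => c * f n x).
Proof. exact/bddM/bdd_cst. Qed.

Lemma bdd_sum (I : finType) (f : I -> nat -> G -> R) :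
  (forall i, bdd (f i)) -> bdd (fun n x => \sum_i f i n x).
Proof.
move=> fb; elim: (index_enum I) => [|i r IH].
  have := bdd_cst 0; congr bdd; apply/funext => n; apply/funext => x.
  by rewrite big_nil.
have := bddD (fb i) IH; congr bdd.
by apply/funext => n; apply/funext => x; rewrite big_cons.
Qed.

Lemma seq_linf_addE (a b : linf nat (linf_group R G)) n (x : G) :
  (a + b) n x = a n x + b n x.
Proof.
have -> : (a + b) n = a n + b n by exact: linf_addE.
exact: (@linf_addE R (carrier G) R[i]^o).
Qed.

Lemma seq_linf_mulE (a b : linf nat (linf_group R G)) n (x : G) :
  (a * b) n x = a n x * b n x.
Proof.
have -> : (a * b) n = a n * b n by exact: linf_mulE.
exact: (@linf_mulE R (carrier G) R[i]^o).
Qed.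

Lemma real_complexD (q r : R) : (q + r)%:C = q%:C + r%:C :> R[i]^o.
Proof. exact: (rmorphD (real_complex R)). Qed.

Lemma real_complexM (q r : R) : (q * r)%:C = q%:C * r%:C :> R[i]^o.
Proof. exact: (rmorphM (real_complex R)). Qed.

Lemma clsD f g : bdd f -> bdd g ->
  cls (fun n x => f n x + g n x) = cls f + cls g.
Proof.
move=> fb gb; have [a -> aE] := cls_spec fb; have [b -> bE] := cls_spec gb.
rewrite -aclassD; apply/esym/cls_near; first exact: bddD.
by apply: filterE => n x; rewrite [LHS]seq_linf_addE real_complexD -aE -bE.
Qed.

Lemma clsM f g : bdd f -> bdd g ->
  cls (fun n x => f n x * g n x) = cls f * cls g.
Proof.
move=> fb gb; have [a -> aE] := cls_spec fb; have [b -> bE] := cls_spec gb.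
rewrite -aclassM; apply/esym/cls_near; first exact: bddM.
by apply: filterE => n x; rewrite [LHS]seq_linf_mulE real_complexM -aE -bE.
Qed.

Lemma cls_cst (c : R) : cls (fun _ _ => c) = c%:C *: 1.
Proof.
rewrite -aclass1 -aclassZ; apply/esym/cls_near; first exact: bdd_cst.
by apply: filterE => n /= x; rewrite [LHS]mulr1.
Qed.

Definition val_at chi (a : A) : R[i] := (chi : character A) a.

Lemma chiD chi f g : bdd f -> bdd g ->
  val_at chi (cls (fun n x => f n x + g n x)) =
  val_at chi (cls f) + val_at chi (cls g).
Proof. by move=> fb gb; rewrite clsD //; exact: rmorphD. Qed.

Lemma chiM chi f g : bdd f -> bdd g ->
  val_at chi (cls (fun n x => f n x * g n x)) =
  val_at chi (cls f) * val_at chi (cls g).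
Proof. by move=> fb gb; rewrite clsM //; exact: rmorphM. Qed.

Lemma chi_cst chi (c : R) : val_at chi (cls (fun _ _ => c)) = c%:C.
Proof.
rewrite cls_cst /val_at; transitivity (c%:C * (1 : R[i])); last exact: mulr1.
by rewrite -(rmorph1 (chi : character A)); exact: linearZ.
Qed.

(** Characters are only assumed to be algebra morphisms. If the value were a + i b with b nonzero,
    (f - a)^2 + b^2 would be bounded below by b^2, hence invertible, yet sent to 0. *)
Lemma chi_real chi f : bdd f -> complex.Im (val_at chi (cls f)) = 0.
Proof.
move=> fb; set z := val_at _ _.
apply/eqP/negPn/negP => b0; pose a := complex.Re z; pose b := complex.Im z.
pose h n x := (f n x + - a) * (f n x + - a) + b * b.
have b2 : 0 < b * b by rewrite -expr2 exprn_even_gt0.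
have hpos n x : b * b <= h n x by rewrite lerDr -expr2 sqr_ge0.
have fab := bddD fb (bdd_cst (- a)).
have hb : bdd h by apply: bddD (bdd_cst _); exact: bddM.
have hVb : bdd (fun n x => (h n x)^-1).
  exists (b * b)^-1 => n x; rewrite ger0_norm ?invr_ge0 ?(le_trans (ltW b2)) //.
  by rewrite lef_pV2 ?posrE // (lt_le_trans b2).
have h1 : (fun n x => h n x * (h n x)^-1) = (fun _ _ => 1).
  apply/funext => n; apply/funext => x; rewrite divff // gt_eqF //.
  exact: lt_le_trans (hpos n x).
have h0 : val_at chi (cls h) = 0.
  rewrite (chiD chi (bddM fab fab) (bdd_cst _)) (chiM chi fab fab).
  rewrite (chiD chi fb (bdd_cst _)) !chi_cst -/z /a /b.
  by case: (z) => u v; simpc; rewrite /= addNr.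
have := chi_cst chi 1; rewrite -h1 chiM // h0 mul0r => /eqP.
by rewrite eq_sym oner_eq0.
Qed.

Definition mean chi f : R := complex.Re (val_at chi (cls f)).

Lemma meanE chi f : bdd f -> val_at chi (cls f) = (mean chi f)%:C.
Proof.
by move=> /(chi_real chi); rewrite /mean; case: (val_at _ _) => u v /= ->.
Qed.

Lemma meanD chi f g : bdd f -> bdd g ->
  mean chi (fun n x => f n x + g n x) = mean chi f + mean chi g.
Proof.
move=> fb gb; apply: complexI; rewrite -meanE; last exact: bddD.
by rewrite chiD // !meanE // -(rmorphD (real_complex R)).
Qed.

Lemma meanM chi f g : bdd f -> bdd g ->
  mean chi (fun n x => f n x * g n x) = mean chi f * mean chi g.
Proof.
move=> fb gb; apply: complexI; rewrite -meanE; last exact: bddM.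
by rewrite chiM // !meanE // -(rmorphM (real_complex R)).
Qed.

Lemma mean_cst chi c : mean chi (fun _ _ => c) = c.
Proof. by rewrite /mean chi_cst. Qed.

Lemma meanZ chi c f : bdd f -> mean chi (fun n x => c * f n x) = c * mean chi f.
Proof. by move=> fb; rewrite meanM ?mean_cst //; exact: bdd_cst. Qed.

Lemma mean_sum (I : finType) chi (f : I -> nat -> G -> R) :
  (forall i, bdd (f i)) ->
  mean chi (fun n x => \sum_i f i n x) = \sum_i mean chi (f i).
Proof.
move=> fb; suff H r : bdd (fun n x => \sum_(i <- r) f i n x) /\
    mean chi (fun n x => \sum_(i <- r) f i n x) = \sum_(i <- r) mean chi (f i).
  by case: (H (index_enum I)).
elim: r => [|i r [IHb IH]].
  rewrite big_nil (_ : (fun _ _ => _) = (fun _ _ => 0)).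
    by split; [exact: bdd_cst|exact: mean_cst].
  by apply/funext => n; apply/funext => x; rewrite big_nil.
rewrite big_cons -IH -meanD // (_ : (fun _ _ => _) =
    (fun n x => f i n x + \sum_(j <- r) f j n x)).
  by split=> //; exact: bddD.
by apply/funext => n; apply/funext => x; rewrite big_cons.
Qed.

(** The class of f is the square of the class of its square root; the value of [Num.sqrt] at
    negative numbers matters only off a set of the ultrafilter. *)
Lemma mean_ge0 chi f : bdd f -> fu_sets U [set n | forall x, 0 <= f n x] ->
  0 <= mean chi f.
Proof.
move=> fb f0; pose g n x := Num.sqrt (f n x).
have gb : bdd g.
  have [B fB] := fb; exists (Num.sqrt B) => n x.
  rewrite ger0_norm ?sqrtr_ge0 // ler_wsqrtr //.
  exact: le_trans (ler_norm _) (fB n x).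
rewrite /mean (cls_eq fb (bddM gb gb)).
  by rewrite -/(mean _ _) meanM // -expr2 sqr_ge0.
by apply: filterS f0 => n /= fn x; rewrite -expr2 sqr_sqrtr.
Qed.

(** The inverse in the dual action cancels the one in the translation of functions. *)
Lemma mean_act (s : GU) chi f : bdd f ->
  mean (spectrum_act (utranslation R G U) s chi) f =
  mean chi (fun n x => f n (repr s n * x)%g).
Proof.
move=> fb; rewrite /mean [val_at _ _](_ : _ =
  val_at chi (utrans (s^-1)%g (cls f))) //; congr (complex.Re (val_at chi _)).
have [a -> aE] := cls_spec fb; rewrite [(s^-1)%g]/(guV s) /guV utrans_class.
apply: cls_near; first by have [B fB] := fb; exists B => n x.
by apply: filterE => n x; rewrite -aE -[in RHS](invgK (repr s n)).
Qed.

Lemma mean_continuous f (chi : spectrum A) (e : R) : bdd f -> 0 < e ->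
  \forall psi \near chi, `|mean chi f - mean psi f| < e.
Proof.
move=> fb e0.
have ec : continuous (fun x : spectrum A => (x : character A) (cls f)).
  move=> x.
  apply: (@continuous_comp (spectrum A) {ptws A -> R[i]^o} R[i]^o
    (fun chi : character A => (chi : A -> R[i]^o)) (fun h => h (cls f))).
    exact: initial_continuous.
  exact: (@proj_continuous A (fun=> R[i]^o) (cls f)).
have e0' : 0 < e%:C by rewrite ltcR.
have /cvgrPdist_lt/(_ _ e0') := ec chi.
apply: filterS => psi; rewrite /= -!/(val_at _ _) !meanE // -rmorphB.
move=> /(le_lt_trans (normc_ge_Re _)); rewrite ltcR.
by rewrite /=.
Qed.

End Characters.

(** * Finitely supported probability measures *)

Section FiniteSupport.
Variables (R : realType) (H : groupType) (N : nat).
Implicit Types (F : 'I_N -> H) (c d : 'I_N -> R).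

(** [F] may repeat points, whose weights then add up. *)
Definition atomic F c t : R := \sum_i (F i == t)%:R * c i.

Lemma esum_atomic F c : (forall i, 0 <= c i) ->
  (\esum_(t in [set: H]) (atomic F c t)%:E = (\sum_i c i)%:E)%E.
Proof.
move=> c0.
rewrite (eq_esum (b := fun t => (\sum_(i < N) ((F i == t)%:R * c i)%:E)%E));
  last by move=> t _; rewrite sumEFin.
rewrite esum_sum; last by move=> t i _ _; rewrite lee_fin mulr_ge0.
rewrite -sumEFin; apply: eq_bigr => i _.
transitivity (\esum_(t in [set F i]) (c i)%:E)%E; last first.
  by rewrite esum_set1 ?lee_fin.
rewrite [RHS]esum_mkcond; apply: eq_esum => t _.
have [<-|ne] := eqVneq (F i) t; first by rewrite mem_set // mul1r.
by rewrite memNset ?mul0r // => /= e; rewrite e eqxx in ne.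
Qed.

Lemma atomic_prob F c : (forall i, 0 <= c i) -> \sum_i c i = 1 ->
  atomic F c \in @prob_pred R H.
Proof.
move=> c0 c1; apply/asboolP; split=> [t|]; last by rewrite esum_atomic // c1.
by apply: sumr_ge0 => i _; rewrite mulr_ge0.
Qed.

Lemma sum_atomic (X : seq H) F c (phi : H -> R) : uniq X ->
  (forall t, t \notin X -> phi t = 0) ->
  \sum_(t <- X) phi t * atomic F c t = \sum_i c i * phi (F i).
Proof.
move=> uX phi0; under eq_bigr do rewrite mulr_sumr.
rewrite exchange_big /=; apply: eq_bigr => i _.
have [FX|FX] := boolP (F i \in X); last first.
  rewrite phi0 // mulr0 big_seq big1 // => t tX.
  by rewrite (_ : F i == t = false) ?mul0r ?mulr0 //; apply: contraNF FX => /eqP ->.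
rewrite (bigD1_seq (F i)) //= eqxx mul1r mulrC big1 ?addr0 // => t tF.
by rewrite eq_sym (negPf tF) mul0r mulr0.
Qed.

(** The l1 norm is a supremum over finite sets; on each of them the sign of the difference is the
    test function that attains it. *)
Lemma l1dist_atomic (xi zeta : prob R H) F F' c d (e : R) :
  xi =1 atomic F c -> zeta =1 atomic F' d ->
  (forall phi : H -> R, (forall t, `|phi t| <= 1) ->
     \sum_i c i * phi (F i) - \sum_i d i * phi (F' i) <= e) ->
  l1dist xi zeta <= e.
Proof.
move=> xiE zetaE dual; rewrite -lee_fin l1dist_fin.
apply: ge_ereal_sup => _ [X [Xfin _] <-].
rewrite fsbig_finite //= sumEFin lee_fin.
pose X' : seq H := finmap.enum_fset (fset_set X).
pose phi t := if t \in X' then Num.sg (xi t - zeta t) else 0.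
have phi1 t : `|phi t| <= 1.
  by rewrite /phi; case: ifP => _; rewrite ?normr0 // normr_sg; case: eqP.
have phi0 t : t \notin X' -> phi t = 0 by rewrite /phi => /negPf ->.
apply: le_trans (dual _ phi1).
rewrite -(sum_atomic _ _ (finmap.fset_uniq _) phi0).
rewrite -(sum_atomic _ _ (finmap.fset_uniq _) phi0).
rewrite -sumrB big_seq [leRHS]big_seq; apply: ler_sum => t tX.
by rewrite -(xiE t) -(zetaE t) -mulrBr /phi tX normrEsg.
Qed.

End FiniteSupport.

Section FiniteFilter.
Variables (T : Type) (F : set_system T).

Lemma filter_fin_forall (FF : Filter F) (I : finType) (P : I -> set T) :
  (forall i, F (P i)) -> F [set x | forall i, P i x].
Proof.
move=> FP; have : F [set x | forall i, i \in enum I -> P i x].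
  elim: (enum I) => [|i r IH]; first by apply: filterE.
  apply: filterS2 (FP i) IH => x Pix IH j; rewrite inE => /predU1P[->//|].
  exact: IH.
by apply: filterS => x /= h i; apply: h; rewrite mem_enum.
Qed.

End FiniteFilter.

(** * From uniform approximations to the ultrapower *)

Section Transfer.
Variables (R : realType) (U : free_ultrafilter) (G : groupType).
Local Notation A := (ultrapower U (linf_group R G)).
Local Notation GU := (gultrapower U G).

(** For each pair with distinct classes the coincidence set is outside the ultrafilter, so its
    complement is inside; finitely many such sets are intersected. *)
Lemma gclass_separate (I : finType) (u : I -> nat -> G) :
  fu_sets U [set n | forall i j, u i n = u j n ->
    gclass U (u i) = gclass U (u j)].
Proof.
pose P (p : I * I) := [set n | u p.1 n = u p.2 n ->
  gclass U (u p.1) = gclass U (u p.2)].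
have : fu_sets U [set n | forall p, P p n].
  apply: filter_fin_forall => -[i j]; rewrite /P /=.
  have [e|ne] := pselect (gclass U (u i) = gclass U (u j)).
    by apply: filterE => n.
  have [h|h] := in_ultra_setVsetC [set n | u i n = u j n] (fu_ultra U).
    by case: ne; apply/gclassP.
  by apply: filterS h => n /= nij /nij.
by apply: filterS => n /= h i j; exact: (h (i, j)).
Qed.

Lemma uniform_approximation (W : word_length G) (l : seq GU) (e : R) : 0 < e ->
  exists eta : spectrum A -> prob R GU, continuous eta /\
    forall s chi, s \in l ->
      l1dist (eta (spectrum_act (utranslation R G U) s chi))
        (prob_trans s (eta chi)) <= e.
Proof.
move=> e0; have [N stage] := uniform_property_A (size l) e0.
have stage_n n := stage G W [seq repr a n | a <- l] (size_map _ _).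
have /choice[p pP] : forall n, exists p : ('I_N -> G) * (G -> 'I_N -> R),
    [/\ forall x i, 0 <= p.2 x i, forall x, \sum_i p.2 x i = 1 &
        forall s x (phi : G -> R), s \in [seq repr a n | a <- l] ->
          (forall t, `|phi t| <= 1) ->
          \sum_i p.2 (s * x)%g i * phi (p.1 i) -
          \sum_i p.2 x i * phi (s * p.1 i)%g <= e].
  by move=> n; have [F [wt ?]] := stage_n n; exists (F, wt).
pose w i n x := (p n).2 x i; pose F i n := (p n).1 i.
have w0 i n x : 0 <= w i n x by have [h _ _] := pP n; exact: h.
have w1 n x : \sum_i w i n x = 1 by have [_ h _] := pP n; exact: h.
have wb i : bdd (w i).
  exists 1 => n x; rewrite ger0_norm // -(w1 n x) (bigD1 i) //= lerDl.
  exact: sumr_ge0.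
have m0 chi i : 0 <= mean (chi : spectrum A) (w i).
  by apply: mean_ge0 => //; apply: filterE => n x.
have m1 chi : \sum_i mean (chi : spectrum A) (w i) = 1.
  rewrite -mean_sum // -(mean_cst chi 1); congr (mean _ _).
  by apply/funext => n; apply/funext => x; exact: w1.
(* As N is the same at every stage, the i-th points form one element of the ultrapower and the i-th
   weights one bounded family, evaluated by the character. *)
pose eta (chi : spectrum A) : prob R GU :=
  Prob (atomic_prob (fun i => gclass U (F i)) (m0 chi) (m1 chi)).
exists eta; split.
- move=> chi; have FF : Filter (nbhs chi) by exact: nbhs_filter.
  apply/cvg_ballP => d d0.
  (* Dividing by N + 1 keeps the sum of N errors strictly below d. *)
  have dN : 0 < d / N.+1%:R by rewrite divr_gt0.
  have := filter_fin_forall FF (fun i => mean_continuous chi (wb i) dN).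
  apply: filterS => psi /= close; rewrite ballEmdist /=.
  apply: (@le_lt_trans _ _ (\sum_(i < N) d / N.+1%:R)); last first.
    rewrite sumr_const card_ord -[ltLHS]mulr_natr mulrAC ltr_pdivrMr //.
    by rewrite ltr_pM2l // ltr_nat.
  apply: (l1dist_atomic (F := fun i => gclass U (F i)) (c := fun i => mean chi (w i))
    (F' := fun i => gclass U (F i)) (d := fun i => mean psi (w i))) => // phi phi1.
  rewrite -sumrB; apply: ler_sum => i _; rewrite -mulrBl.
  apply: (le_trans (ler_norm _)); rewrite normrM.
  by rewrite -[leRHS]mulr1 ler_pM // ltW.
move=> s chi sl; pose sn := repr s.
apply: (l1dist_atomic (F := fun i => gclass U (F i))
    (c := fun i => mean (spectrum_act (utranslation R G U) s chi) (w i))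
    (F' := fun i => (s * gclass U (F i))%g)
    (d := fun i => mean chi (w i))) => // [t|phi phi1].
  rewrite /= /atomic; apply: eq_bigr => i _; congr ((nat_of_bool _)%:R * _).
  by rewrite -(inj_eq (mulgI s)) mulVKg.
have sFE i : (s * gclass U (F i))%g = gclass U (fun n => (sn n * F i n)%g).
  by rewrite -[X in (X * _)%g](gclass_repr s) [LHS]guM_class.
(* All the points, before and after translation, at which the test function is evaluated. *)
pose u (o : 'I_N + 'I_N) n :=
  match o with inl i => F i n | inr i => (sn n * F i n)%g end.
(* The mean of [g] under chi is the dual expression to be bounded, so it suffices that g <= e at
   almost every stage. *)
pose g n x := \sum_i ((phi (gclass U (F i))) * w i n (sn n * x)%g +
                      (- phi (s * gclass U (F i))%g) * w i n x).
have wsb i : bdd (fun n x => w i n (sn n * x)%g).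
  by have [B wB] := wb i; exists B => n x.
have gb : bdd g by apply: bdd_sum => i; apply: bddD; exact: bddZ.
have gle : fu_sets U [set n | forall x, g n x <= e].
  apply: filterS (gclass_separate u) => n /= sep x.
  (* [phi] pulled back to stage n: by [sep] the choice of o does not matter, and 0 is the value away
     from the listed points. *)
  pose phin t := if [pick o | u o n == t] is Some o then phi (gclass U (u o)) else 0.
  have phinE o : phin (u o n) = phi (gclass U (u o)).
    rewrite /phin; case: pickP => [o' /eqP/sep ->//|/(_ o)].
    by rewrite eqxx.
  have [_ _ /(_ (sn n) x phin)] := pP n.
  rewrite (map_f (fun a : GU => repr a n) sl) => /(_ isT).
  have -> : g n x = \sum_i (p n).2 (sn n * x)%g i * phin ((p n).1 i) -
      \sum_i (p n).2 x i * phin (sn n * (p n).1 i)%g.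
    rewrite -sumrB; apply: eq_bigr => i _.
    rewrite (phinE (inl i) : phin ((p n).1 i) = _).
    rewrite (phinE (inr i) : phin (sn n * (p n).1 i)%g = _) -sFE.
    by rewrite mulNr; congr (_ - _); rewrite mulrC.
  apply=> t; rewrite /phin; case: pickP => [o _|_]; first exact: phi1.
  by rewrite normr0.
have : 0 <= mean chi (fun n x => e + -1 * g n x).
  apply: mean_ge0; first by apply: bddD; [exact: bdd_cst|exact: bddZ].
  by apply: filterS gle => n /= h x; rewrite mulN1r subr_ge0.
rewrite meanD ?mean_cst ?meanZ //; [|exact: bdd_cst|exact: bddZ].
rewrite mulN1r subr_ge0; apply: le_trans.
rewrite /g mean_sum => [|i]; last by apply: bddD; exact: bddZ.
rewrite -sumrB le_eqVlt; apply/orP; left; apply/eqP/eq_bigr => i _.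
rewrite meanD; [|exact: bddZ..].
by rewrite !meanZ // mean_act // mulNr; congr (_ - _); rewrite mulrC.
Qed.

End Transfer.

(** * The net indexed by finite lists and precisions *)

Theorem theoremA (R : realType) (U : free_ultrafilter) (G : groupType) :
  free_group G -> uniformly_exact R U G.
Proof.
move=> /free_group_word_length[W].
pose A := ultrapower U (linf_group R G); pose GU := gultrapower U G.
pose I : Type := (seq GU * nat)%type.
have /choice[eta etaP] : forall i : I, exists eta : spectrum A -> prob R GU,
    continuous eta /\ forall s chi, s \in i.1 ->
      l1dist (eta (spectrum_act (utranslation R G U) s chi))
        (prob_trans s (eta chi)) <= i.2.+1%:R^-1.
  by move=> i; apply: uniform_approximation => //; rewrite invr_gt0.
pose le (i j : I) := {subset i.1 <= j.1} /\ (i.2 <= j.2)%N.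
have le_trans' i j k : le i j -> le j k -> le i k.
  move=> [ij1 ij2] [jk1 jk2]; split; last exact: leq_trans jk2.
  by move=> s /ij1/jk1.
have le_ub i j : exists k, le i k /\ le j k.
  exists (i.1 ++ j.1, maxn i.2 j.2); split; split=> /=.
  - by move=> s si; rewrite mem_cat si.
  - exact: leq_maxl.
  - by move=> s sj; rewrite mem_cat sj orbT.
  - exact: leq_maxr.
have FF : Filter (tails le).
  apply: filter_from_filter; first by exists ([::], 0%N).
  move=> i j _ _; have [k [ik jk]] := le_ub i j.
  by exists k => // k' kk'; split; apply: le_trans' kk'.
exists I, le, eta; split.
- by split; [exists ([::], 0%N)|move=> i; split|exact: le_trans'|exact: le_ub].
- by move=> i; case: (etaP i).
move=> s; apply/cvgrPdist_lt => e e0.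
have [m mP] : exists m : nat, m.+1%:R^-1 < e.
  have eV : 0 <= e^-1 by rewrite invr_ge0 ltW.
  exists (Num.bound e^-1); rewrite -[ltRHS]invrK ltf_pV2 ?posrE ?invr_gt0 //.
  have := archi_boundP eV.
  by move/lt_trans; apply; rewrite ltr_nat.
exists ([:: s], m) => // i [si mi] /=.
rewrite sub0r normrN; apply: le_lt_trans mP.
have bnd chi : l1dist (eta i (spectrum_act (utranslation R G U) s chi))
    (prob_trans s (eta i chi)) <= m.+1%:R^-1.
  have [_ h] := etaP i; apply: (le_trans (h s chi _)).
    by apply: si; rewrite mem_seq1.
  by rewrite lef_pV2 ?posrE // ler_nat ltnS.
set X := (X in sup X); have X0 x : X x -> 0 <= x.
  case=> chi _ <-; rewrite -lee_fin l1dist_fin.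
  by apply: esum_ge0 => t _; rewrite lee_fin.
have Xm x : X x -> x <= m.+1%:R^-1 by case=> chi _ <-.
(* Nonemptiness of the spectrum is not established; over the empty set the supremum is 0 by
   convention. *)
have [->|/set0P[x Xx]] := eqVneq X set0.
  by rewrite sup0 normr0 invr_ge0.
rewrite ger0_norm; first by apply: ge_sup; [exists x|].
by apply: le_trans (X0 _ Xx) _; apply: ub_le_sup => //; exists m.+1%:R^-1.
Qed.
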